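(* Let $P$ be a $d$-polytope. (i) If $P$ is simplicial, then $\mathcal{R}_{\mathbf 0}(P)$ is a smooth manifold of dimension $d f_0(P)$. (ii) If $P$ is simple, then $\mathcal{R}_{\mathbf 0}(P)$ is a smooth manifold of dimension $d f_{d-1}(P)$.
   Context: A $d$-polytope is a $d$-dimensional convex polytope. Polytopes are labeled: the $n=f_0(P)$ vertices and $m=f_{d-1}(P)$ facets are numbered. A $d$-polytope is simplicial if every facet is a simplex, and simple if every vertex lies in exactly $d$ facets. A labeled $d$-polytope $Q\subset\mathbb{R}^d$ realizes $P$ if there is an isomorphism between the face lattices of $P$ and $Q$ respecting the labels of vertices and facets. The centered realization space is $$\mathcal{R}_{\mathbf 0}(P)=\{(V,A)\in\mathbb{R}^{d\times(n+m)} \mid \operatorname{conv}(V)=\{\mathbf x\in\mathbb{R}^d\mid A^t\mathbf x\le\mathbf 1\}\text{ realizes }P\},$$ where $\operatorname{conv}(V)$ is the convex hull of the columns of $V$. ''Smooth manifold'' means smoothly embedded submanifold of $\mathbb{R}^{d\times(n+m)}$. *)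

(* Defs.v *)
From mathcomp Require Import all_boot all_order all_algebra.
From mathcomp Require Import boolp classical_sets functions cardinality reals.
From mathcomp Require Import topology normedtype derive.

Set Implicit Arguments.
Unset Strict Implicit.
Unset Printing Implicit Defensive.

Import Order.TTheory GRing.Theory Num.Theory.
Import numFieldNormedType.Exports.

Local Open Scope classical_set_scope.
Local Open Scope card_scope.
Local Open Scope ring_scope.

Section Polytopes.
Variables (R : realType) (D : nat).

(* Finite point configurations in R^D are given by the columns of a matrix. *)
Definition conv_hull n (V : 'M[R]_(D, n)) : set 'cV[R]_D :=
  [set V *m w | w in [set w : 'cV[R]_n |
     (forall i, 0 <= w i 0) /\ \sum_i w i 0 = 1]].

Definition aff_hull n (V : 'M[R]_(D, n)) : set 'cV[R]_D :=
  [set V *m w | w in [set w : 'cV[R]_n | \sum_i w i 0 = 1]].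

Definition aff_indep n (V : 'M[R]_(D, n)) : Prop :=
  forall w : 'cV[R]_n, V *m w = 0 -> \sum_i w i 0 = 0 -> w = 0.

(* The dimension is an integer, because the empty set has dimension -1. *)
Definition has_dim (S : set 'cV[R]_D) (k : int) : Prop :=
  exists r (V : 'M[R]_(D, r)),
    [/\ k = r%:Z - 1, aff_indep V, forall j, S (col j V) & S `<=` aff_hull V].

Definition polytope (d : nat) (P : set 'cV[R]_D) : Prop :=
  has_dim P d%:Z /\ exists n (V : 'M[R]_(D, n)), P = conv_hull V.

(* Both the empty face (c = 0, b = 1) and P itself (c = 0, b = 0) are faces. *)
Definition face (P F : set 'cV[R]_D) : Prop :=
  exists (c : 'cV[R]_D) (b : R),
    (forall x, P x -> (c^T *m x) 0 0 <= b) /\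
    F = P `&` [set x | (c^T *m x) 0 0 = b].

Definition vertex (P : set 'cV[R]_D) (v : 'cV[R]_D) : Prop := face P [set v].

(* The facets of a d-dimensional P. *)
Definition facet (d : nat) (P F : set 'cV[R]_D) : Prop :=
  face P F /\ has_dim F (d%:Z - 1).

Definition simplex (S : set 'cV[R]_D) : Prop :=
  exists r (V : 'M[R]_(D, r)), aff_indep V /\ S = conv_hull V.

Definition simplicial (d : nat) (P : set 'cV[R]_D) : Prop :=
  forall F, facet d P F -> simplex F.

Definition simple_polytope (d : nat) (P : set 'cV[R]_D) : Prop :=
  forall v, vertex P v -> [set F | facet d P F /\ F v] #= `I_d.

(* The labels are bijections, so n = f_0 and m = f_{d-1}. *)
Record labeled_polytope (d n m : nat) := LabeledPolytope {
  body :> set 'cV[R]_D;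
  vert : 'I_n -> 'cV[R]_D;
  fct : 'I_m -> set 'cV[R]_D;
  body_polytope : polytope d body;
  vert_bij : set_bij setT (vertex body) vert;
  fct_bij : set_bij setT (facet d body) fct
}.

End Polytopes.

Definition realizes (R : realType) (D d n m : nat)
    (P : labeled_polytope R D d n m) (Q : labeled_polytope R d d n m) : Prop :=
  exists phi : set 'cV[R]_D -> set 'cV[R]_d,
    [/\ set_bij (face P) (face Q) phi,
        forall F G, face P F -> face P G -> (phi F `<=` phi G <-> F `<=` G),
        forall i, phi [set vert P i] = [set vert Q i]
      & forall j, phi (fct P j) = fct Q j].

(* Vertex i of the realization is column i of V, and its facet j is the set
   where the j-th inequality of A^T x <= 1 is tight. *)
Definition centered_realization_space (R : realType) (D d n m : nat)
    (P : labeled_polytope R D d n m) : set 'M[R]_(d, n + m) :=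
  [set M | let V := lsubmx M in let A := rsubmx M in
     conv_hull V = [set x | forall j, (A^T *m x) j 0 <= 1] /\
     exists Q : labeled_polytope R d d n m,
       [/\ body Q = conv_hull V,
           forall i, vert Q i = col i V,
           forall j, fct Q j = conv_hull V `&` [set x | (A^T *m x) j 0 = 1]
         & realizes P Q]].

Section Smooth.
Variable R : realType.

(* f is C^k on U, for U open. Iterated directional derivatives stand for the
   partial derivatives, so this is meant for finite-dimensional spaces. *)
Fixpoint Ck (E F : normedModType R) (k : nat) (U : set E) (f : E -> F) : Prop :=
  match k with
  | 0 => forall x, U x -> {for x, continuous f}
  | k'.+1 => (forall x, U x -> differentiable f x) /\
             forall v, Ck k' U ('D_v f)
  end.

Definition smooth (E F : normedModType R) (U : set E) (f : E -> F) : Prop :=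
  forall k, Ck k U f.

Definition diffeo (E F : normedModType R) (U : set E) (W : set F)
    (f : E -> F) (g : F -> E) : Prop :=
  [/\ open U, open W, smooth U f, smooth W g &
      [/\ f @` U = W, g @` W = U,
          forall x, U x -> g (f x) = x & forall y, W y -> f (g y) = y]].

(* Embedded submanifolds of R^(p x q), through slice charts. *)
Definition smooth_submanifold (p q k : nat) (M : set 'M[R]_(p, q)) : Prop :=
  (k <= p * q)%N /\
  forall x, M x ->
    exists (U : set 'M[R]_(p, q)) (W : set 'rV[R]_(p * q))
           (f : 'M[R]_(p, q) -> 'rV[R]_(p * q))
           (g : 'rV[R]_(p * q) -> 'M[R]_(p, q)),
      [/\ U x, diffeo U W f g &
          f @` (M `&` U) =
            W `&` [set y | forall j : 'I_(p * q), (k <= j)%N -> y 0 j = 0]].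

End Smooth.

(* Main.v *)
Require Import Defs.
From HB Require Import structures.
From mathcomp Require Import all_boot all_order perm all_algebra.
From mathcomp Require Import boolp classical_sets functions cardinality reals.
From mathcomp Require Import topology normedtype landau derive.

(** A point (V, A) of the realization space is a pair for which conv V is the
polyhedron A^T x <= 1, and its combinatorics is the set of pairs (i, j) with
a_j . v_i = 1.  When every vertex lies on exactly d facets, the d vectors a_j of
the facets through v_i form a basis, so v_i is the unique solution of d linear
equations in A: on the realization space V is a function of A, given by
inverse matrices and hence smooth.  The space is thus contained in a graph over
an open set of the d m coordinates of A, and it remains to see that it is the
whole graph over the open set where the non-incident pairs still satisfy
a_j . v_i < 1.  The simplicial case is the same statement for the pair (A, V).

Exchanging V and A is legitimate because of polarity ([dual_pair_sym]): in
positive dimension, conv V = (A^T x <= 1) implies conv A = (V^T y <= 1).  This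
rests on the Farkas lemma through the separation of a point from a convex hull.

That a perturbed pair is still dual ([dual_pair_of_neighbors]) is an argument in
the style of the simplex method which needs no smallness of the perturbation.
In the original simple polytope, each vertex i has for each of its facets k a
neighbor lying on all the other facets of i but not on k ([vertex_neighbor]);
this is a statement about incidences, so it persists.  A linear form c which is
maximal over the columns of V at v_i then has nonnegative coordinates in the
basis of the a_j through v_i, because c does not increase towards any neighbor,
and so c is bounded on A^T x <= 1 by its value at v_i.  Hence no point of that
polyhedron can be separated from conv V.

That the perturbed pair still realizes P ([centered_realization_spaceE]) follows
because a face is determined by the facet inequalities that are tight on it
([face_tface]), which is again Farkas; two dual pairs with the same incidences
therefore have isomorphic face lattices ([transfer_bij], [transfer_sub]).
Vertices and facets are recognized by the incidences being an antichain in both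
directions.

The slice charts are obtained from the graph description by subtracting the
smooth function ([graph_slice_chart]); smoothness is proved by closing the C^k
condition under sums, products, inverses and composition with linear maps.  In
dimension 0 the ambient space is a point. *)

Set Implicit Arguments.
Unset Strict Implicit.
Unset Printing Implicit Defensive.

Import Order.TTheory GRing.Theory Num.Theory.
Import numFieldNormedType.Exports.

Local Open Scope classical_set_scope.
Local Open Scope ring_scope.

(** * Calculus of C^k maps between normed spaces *)

Section CkTheory.
Variables (R : realType) (E F : normedModType R).
Implicit Types (U : set E) (k : nat).

Lemma Ck_pred k U (f : E -> F) : Ck k.+1 U f -> Ck k U f.
Proof.
elim: k f => [|k IH] f [df Df].
  by move=> x Ux; apply: differentiable_continuous; apply: df.
by split=> // v; apply: IH; apply: Df.
Qed.

Lemma differentiable_near_eq (f g : E -> F) (x : E) :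
  (\forall y \near x, f y = g y) -> differentiable f x -> differentiable g x.
Proof.
move=> fg df; have [dfc dfo] := (diff_locallyP x f).1 df.
have e : g \o shift x = cst (g x) + 'd f x +o_ 0 id.
  apply/eqaddoP => eps eps0.
  have /eqaddoP /(_ _ eps0) := dfo.
  have fgx : f x = g x by exact: nbhs_singleton fg.
  have fg0 : \forall h \near 0, f (h + x) = g (h + x).
    by move: fg; rewrite (near_shift 0) /= subr0.
  move=> H; near=> h.
  rewrite !fctE /= -fgx -(near fg0 h)//.
  by near: h; exact: H.
have ed : 'd g x = 'd f x :> (E -> F) by exact: (diff_unique dfc e).
by apply/diff_locallyP; rewrite ed.
Unshelve. all: by end_near. Qed.

(** On an open set every condition in [Ck] depends only on germs; this licenses
replacing a derivative by a formula that holds only on the set. *)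
Lemma Ck_ext k U (f g : E -> F) : open U -> (forall x, U x -> f x = g x) ->
  Ck k U f -> Ck k U g.
Proof.
move=> oU; elim: k f g => [|k IH] f g fg.
  move=> cf x Ux; suff : g @ x --> f x by rewrite (fg x Ux).
  apply: cvg_trans (cf x Ux); apply: near_eq_cvg.
  by near=> y; apply/fg; near: y; apply: open_nbhs_nbhs.
case=> df Df.
have nfg x : U x -> \forall y \near x, f y = g y.
  by move=> Ux; near=> y; apply/fg; near: y; apply: open_nbhs_nbhs.
split=> [x Ux|v].
  by apply: differentiable_near_eq (df x Ux); apply: nfg.
apply: (IH ('D_v f)); last exact: Df.
by move=> x Ux; apply: near_eq_derive; apply: nfg.
Unshelve. all: by end_near. Qed.

Lemma Ck_cst k U (a : F) : Ck k U (cst a : E -> F).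
Proof.
elim: k a => [|k IH] a; first by move=> x _; apply: cst_continuous.
split=> [x _|v]; first exact: differentiable_cst.
have -> : 'D_v (cst a : E -> F) = cst 0 by apply/funext => x; apply: derive_cst.
exact: IH.
Qed.

Lemma CkD k U (f g : E -> F) : open U -> Ck k U f -> Ck k U g -> Ck k U (f + g).
Proof.
move=> oU; elim: k f g => [|k IH] f g.
  by move=> cf cg x Ux; apply: cvgD; [apply: cf|apply: cg].
move=> [df Df] [dg Dg]; split=> [x Ux|v].
  by apply: differentiableD; [apply: df|apply: dg].
apply: (@Ck_ext _ _ ('D_v f + 'D_v g)) => //; last by apply: IH; [exact: Df|exact: Dg].
move=> x Ux; rewrite deriveD //; apply: diff_derivable; [exact: df|exact: dg].
Qed.

Lemma Ck_sum k U (I : Type) (r : seq I) (P : pred I) (f : I -> E -> F) :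
  open U -> (forall i, Ck k U (f i)) -> Ck k U (fun x => \sum_(i <- r | P i) f i x).
Proof.
move=> oU Cf; elim: r => [|i r IH].
  have -> : (fun x => \sum_(i <- [::] | P i) f i x) = cst 0.
    by apply/funext => x; rewrite big_nil.
  exact: Ck_cst.
have [Pi|nPi] := boolP (P i).
  have -> : (fun x => \sum_(i <- i :: r | P i) f i x) =
      f i + (fun x => \sum_(i <- r | P i) f i x).
    by apply/funext => x; rewrite big_cons Pi.
  exact: CkD.
suff -> : (fun x => \sum_(i <- i :: r | P i) f i x) =
      (fun x => \sum_(i <- r | P i) f i x) by [].
by apply/funext => x; rewrite big_cons (negbTE nPi).
Qed.

Lemma Ck_linear k U (L : E -> F) : linear L -> continuous L -> Ck k U L.
Proof.
move=> linL cL.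
have @L' : {linear E -> F} := HB.pack L (GRing.isLinear.Build _ _ _ _ _ linL).
case: k => [x _|k]; first exact: cL.
split=> [x _|v]; first exact: (@linear_differentiable _ _ _ L').
have -> : 'D_v L = cst (L v).
  apply/funext => x; rewrite deriveE; last exact: (@linear_differentiable _ _ _ L').
  by rewrite (@diff_lin _ _ _ L').
exact: Ck_cst.
Qed.

End CkTheory.

Section CkComp.
Variables (R : realType) (E F G : normedModType R).

Lemma Ck_postcomp k (U : set E) (f : E -> F) (L : F -> G) :
  open U -> linear L -> continuous L -> Ck k U f -> Ck k U (L \o f).
Proof.
move=> oU linL cL.
have @L' : {linear F -> G} := HB.pack L (GRing.isLinear.Build _ _ _ _ _ linL).
have dL y : differentiable L y by exact: (@linear_differentiable _ _ _ L').
have dLE y w : 'd L y w = L w by rewrite (@diff_lin _ _ _ L').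
elim: k f => [|k IH] f.
  by move=> cf x Ux; apply: continuous_comp; [apply: cf|apply: cL].
case=> df Df; split=> [x Ux|v].
  by apply: differentiable_comp => //; apply: df.
apply: (@Ck_ext _ _ _ _ _ (L \o 'D_v f)) => //; last by apply: IH; exact: Df.
move=> x Ux /=; have dfx := df x Ux.
rewrite !deriveE //; last exact: differentiable_comp.
by rewrite (@diff_comp _ _ _ _ f L) //= dLE.
Qed.

Lemma Ck_precomp k (U : set F) (L : E -> F) (f : F -> G) :
  open U -> linear L -> continuous L -> Ck k U f -> Ck k (L @^-1` U) (f \o L).
Proof.
move=> oU linL cL.
have @L' : {linear E -> F} := HB.pack L (GRing.isLinear.Build _ _ _ _ _ linL).
have dL y : differentiable L y by exact: (@linear_differentiable _ _ _ L').
have dLE y w : 'd L y w = L w by rewrite (@diff_lin _ _ _ L').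
have oLU : open (L @^-1` U) by apply: open_comp => // x _; apply: cL.
elim: k f => [|k IH] f.
  by move=> cf x Ux; apply: continuous_comp; [apply: cL|apply: cf].
case=> df Df; split=> [x Ux|v].
  by apply: differentiable_comp => //; apply: df.
have dcomp x : (L @^-1` U) x -> 'D_v (f \o L) x = ('D_(L v) f \o L) x.
  move=> Ux; have dfx := df _ Ux.
  rewrite /= !deriveE //; last exact: differentiable_comp.
  by rewrite (@diff_comp _ _ _ _ L f) //= dLE.
apply: (@Ck_ext _ _ _ _ _ ('D_(L v) f \o L)) => // [x Ux|]; first by rewrite dcomp.
by apply: IH; exact: Df.
Qed.

End CkComp.

(** * C^k functions of matrices *)

Section CkScalar.
Variables (R : realType) (E : normedModType R).
Implicit Types (U : set E) (k : nat).

Lemma CkM k U (f g : E -> R) : open U -> Ck k U f -> Ck k U g -> Ck k U (f * g).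
Proof.
move=> oU; elim: k f g => [|k IH] f g.
  by move=> cf cg x Ux; apply: cvgM; [apply: cf|apply: cg].
move=> Cf Cg; have [[df Df] [dg Dg]] := (Cf, Cg); split=> [x Ux|v].
  by apply: differentiableM; [apply: df|apply: dg].
apply: (@Ck_ext _ _ _ _ _ (f * 'D_v g + g * 'D_v f)) => //.
  move=> x Ux; rewrite deriveM //; apply: diff_derivable; [exact: df|exact: dg].
by apply: CkD => //; apply: IH; do ?[exact: Df|exact: Dg]; apply: Ck_pred.
Qed.

(** Induction on k through (1/f)' = - (1/f)^2 f', whose factor 1/f is C^k by the
induction hypothesis. *)
Lemma CkV k U (f : E -> R) : open U -> (forall x, U x -> f x != 0) ->
  Ck k U f -> Ck k U (fun x => (f x)^-1).
Proof.
move=> oU f0; elim: k => [|k IH].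
  by move=> cf x Ux; apply: cvgV; [apply: f0|apply: cf].
move=> Cf; have [df Df] := Cf; have CVf := IH (Ck_pred Cf).
split=> [x Ux|v]; first by apply: differentiableV; [apply: df|apply: f0].
pose h : E -> R := fun x => (f x)^-1.
apply: (@Ck_ext _ _ _ _ _ (cst (-1) * (h * h) * 'D_v f)) => //.
  move=> x Ux; rewrite deriveV //; [|exact: f0|apply: diff_derivable; exact: df].
  by rewrite !fctE /= /h expr2 invfM mulN1r.
apply: CkM => //; last exact: Df.
by apply: CkM => //; [exact: Ck_cst|exact: CkM].
Qed.

Lemma Ck_prod k U (I : Type) (r : seq I) (f : I -> E -> R) :
  open U -> (forall i, Ck k U (f i)) -> Ck k U (fun x => \prod_(i <- r) f i x).
Proof.
move=> oU Cf; elim: r => [|i r IH].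
  have -> : (fun x => \prod_(i <- [::]) f i x) = cst 1.
    by apply/funext => x; rewrite big_nil.
  exact: Ck_cst.
have -> : (fun x => \prod_(i <- i :: r) f i x) =
      f i * (fun x => \prod_(i <- r) f i x).
  by apply/funext => x; rewrite big_cons.
exact: CkM.
Qed.

Lemma Ck_coord k p q (U : set 'M[R]_(p, q)) i j :
  Ck k U (fun M : 'M[R]_(p, q) => M i j : R).
Proof.
apply: Ck_linear; last exact: coord_continuous.
by move=> a M N; rewrite !mxE.
Qed.

(** A matrix-valued map is the sum of its entries times constant matrices, so it is
a sum of scalar functions followed by the linear maps t |-> t E_ij. *)
Lemma Ck_mx k p q U (f : E -> 'M[R]_(p, q)) : open U ->
  (forall i j, Ck k U (fun x => f x i j)) -> Ck k U f.
Proof.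
move=> oU Cf.
have -> : f = fun x => \sum_i \sum_j f x i j *: delta_mx i j.
  by apply/funext => x; rewrite -matrix_sum_delta.
do 2![apply: Ck_sum => // ?].
apply: (@Ck_postcomp _ _ _ _ _ _ (fun x => f x _ _) (fun c => c *: delta_mx _ _)) => //.
  by move=> a b c; rewrite scalerDl scalerA.
exact: scalel_continuous.
Qed.

Lemma Ck_entry k p q U (f : E -> 'M[R]_(p, q)) i j :
  open U -> Ck k U f -> Ck k U (fun x => f x i j).
Proof.
move=> oU Cf; apply: (@Ck_postcomp _ _ _ _ _ _ f (fun M : 'M[R]_(p, q) => M i j)) => //.
  by move=> a M N; rewrite !mxE.
exact: coord_continuous.
Qed.

Lemma linear_mx_continuous p q p' q' (L : 'M[R]_(p, q) -> 'M[R]_(p', q')) :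
  linear L -> continuous L.
Proof.
move=> linL.
have @L' : {linear 'M[R]_(p, q) -> 'M[R]_(p', q')} :=
  HB.pack L (GRing.isLinear.Build _ _ _ _ _ linL).
have LE : L = fun M => \sum_i \sum_j M i j *: L (delta_mx i j).
  apply/funext => M; rewrite {1}(matrix_sum_delta M) -[LHS]/(L' _) linear_sum.
  by apply: eq_bigr => i _; rewrite linear_sum; apply: eq_bigr => j _; rewrite linearZ.
suff: Ck 0 setT L by move=> cL x; apply: cL.
rewrite LE; do 2![apply: Ck_sum => [|?]; first exact: openT].
apply: (@Ck_postcomp _ _ _ _ _ _ (fun M : 'M[R]_(p, q) => M _ _)
  (fun c => c *: L (delta_mx _ _))).
- exact: openT.
- by move=> a b c; rewrite scalerDl scalerA.
- exact: scalel_continuous.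
- exact: Ck_coord.
Qed.

Lemma Ck_det k d U (f : E -> 'M[R]_d) : open U -> Ck k U f ->
  Ck k U (fun x => \det (f x)).
Proof.
move=> oU Cf; rewrite /determinant; apply: Ck_sum => // s.
apply: (@CkM _ _ (cst ((-1) ^+ s)) (fun x => \prod_i f x i (s i))) => //.
  exact: Ck_cst.
by apply: Ck_prod => // i; apply: Ck_entry.
Qed.

Lemma Ck_submx k p q p' q' U (f : E -> 'M[R]_(p, q))
    (g : 'I_p' -> 'I_p) (h : 'I_q' -> 'I_q) :
  open U -> Ck k U f -> Ck k U (fun x => mxsub g h (f x)).
Proof.
move=> oU Cf; apply: Ck_mx => // i j.
have -> : (fun x => mxsub g h (f x) i j) = (fun x => f x (g i) (h j)).
  by apply/funext => x; rewrite !mxE.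
exact: Ck_entry.
Qed.

(** By Cramer's rule the entries of the inverse are polynomials in the entries
divided by the determinant. *)
Lemma Ck_invmx k d U (f : E -> 'M[R]_d) : open U ->
  (forall x, U x -> f x \in unitmx) -> Ck k U f -> Ck k U (fun x => invmx (f x)).
Proof.
move=> oU fU Cf; apply: Ck_mx => // i j.
have Cdet : Ck k U (fun x => (\det (f x))^-1).
  by apply: CkV => //; [move=> x /fU; rewrite unitmxE unitfE|exact: Ck_det].
have Cadj : Ck k U (fun x => cofactor (f x) j i).
  rewrite /cofactor.
  apply: (@Ck_ext _ _ _ _ _ (cst ((-1) ^+ (j + i)) *
    (fun x => \det (row' j (col' i (f x)))))) => //.
  apply: CkM => //.
    exact: Ck_cst.
  apply: Ck_det => //; apply: Ck_mx => // a b.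
  have -> : (fun x => row' j (col' i (f x)) a b) =
            (fun x => f x (lift j a) (lift i b)) by apply/funext => x; rewrite !mxE.
  exact: Ck_entry.
apply: Ck_ext (CkM oU Cdet Cadj) => // x Ux.
by rewrite /invmx fU // !mxE.
Qed.

End CkScalar.

(** * Graphs of smooth maps are submanifolds *)

Section Graph.
Variables (R : realType) (d a b q : nat).
Variables (pX : 'M[R]_(d, q) -> 'M[R]_(d, a)) (pY : 'M[R]_(d, q) -> 'M[R]_(d, b)).
Variables (jX : 'M[R]_(d, a) -> 'M[R]_(d, q)) (jY : 'M[R]_(d, b) -> 'M[R]_(d, q)).
Hypotheses (pX_lin : linear pX) (pY_lin : linear pY).
Hypotheses (jX_lin : linear jX) (jY_lin : linear jY).
Hypothesis jpK : forall M, jX (pX M) + jY (pY M) = M.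
Hypothesis pXj : forall X Y, pX (jX X + jY Y) = X.
Hypothesis pYj : forall X Y, pY (jX X + jY Y) = Y.
Variables (N : set 'M[R]_(d, a)) (h : 'M[R]_(d, a) -> 'M[R]_(d, b)).
Hypotheses (oN : open N) (sh : smooth N h).

Lemma open_preimage_linear p' q' (L : 'M[R]_(p', q') -> 'M[R]_(d, a)) :
  linear L -> open (L @^-1` N).
Proof. by move=> lL; apply: open_comp => // x _; apply: linear_mx_continuous. Qed.

(** The shear (X, Y) |-> (X, Y - h X) straightens the graph of h to the slice Y = 0.
The dimension r is kept abstract, so that it can be instantiated with a number
that equals d a + d b without a cast on row vectors. *)
Lemma graph_slice_chart r (e : (d * a + d * b = r)%N) :
  exists (W : set 'rV[R]_r) (f : 'M[R]_(d, q) -> 'rV[R]_r)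
    (g : 'rV[R]_r -> 'M[R]_(d, q)),
    diffeo (pX @^-1` N) W f g /\
    f @` [set M | N (pX M) /\ pY M = h (pX M)] =
      W `&` [set y | forall j : 'I_r, (d * a <= j)%N -> y 0 j = 0].
Proof.
case: _ / e.
pose yX (y : 'rV[R]_(d * a + d * b)) : 'M[R]_(d, a) := vec_mx (lsubmx y).
pose yY (y : 'rV[R]_(d * a + d * b)) : 'M[R]_(d, b) := vec_mx (rsubmx y).
have yX_lin : linear yX by move=> c y z; rewrite /yX !linearP.
have yY_lin : linear yY by move=> c y z; rewrite /yY !linearP.
pose f M := row_mx (mxvec (pX M)) (mxvec (pY M - h (pX M))).
pose g y := jX (yX y) + jY (yY y + h (yX y)).
have jYD Y Z : jY (Y + Z) = jY Y + jY Z by rewrite -[Y]scale1r jY_lin !scale1r.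
have fX M : yX (f M) = pX M by rewrite /yX row_mxKl mxvecK.
have fY M : yY (f M) = pY M - h (pX M) by rewrite /yY row_mxKr mxvecK.
have gf M : g (f M) = M by rewrite /g fX fY subrK jpK.
have gX y : pX (g y) = yX y by rewrite /g pXj.
have fg y : f (g y) = y.
  by rewrite /f gX /g pYj addrK /yX /yY !vec_mxK hsubmxK.
exists (yX @^-1` N), f, g; split.
  have oU := open_preimage_linear pX_lin; have oW := open_preimage_linear yX_lin.
  split=> //.
  - move=> k.
    pose L1 M := row_mx (mxvec (pX M)) (mxvec (pY M)).
    pose L2 (Y : 'M[R]_(d, b)) : 'rV[R]_(d * a + d * b) := row_mx 0 (- mxvec Y).
    have L1_lin : linear L1.
      by move=> c y z; rewrite /L1 pX_lin pY_lin !linearP scale_row_mx add_row_mx.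
    have L2_lin : linear L2.
      move=> c y z; rewrite /L2 linearP scale_row_mx add_row_mx scaler0 addr0.
      by rewrite opprD scalerN.
    have -> : f = L1 + (L2 \o (h \o pX)).
      apply/funext => M; rewrite !fctE /= /L1 /L2 add_row_mx addr0.
      by rewrite /f linearB.
    apply: CkD => //; first exact/Ck_linear/linear_mx_continuous.
    apply: Ck_postcomp => //; first exact: linear_mx_continuous.
    by apply: Ck_precomp => //; exact: linear_mx_continuous.
  - move=> k.
    pose L1 y := jX (yX y) + jY (yY y).
    have L1_lin : linear L1.
      move=> c y z; rewrite /L1 yX_lin yY_lin jX_lin jY_lin scalerDr.
      by rewrite !addrA (addrAC (c *: _)).
    have -> : g = L1 + (jY \o (h \o yX)).
      by apply/funext => y; rewrite !fctE /= /L1 -addrA -jYD.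
    apply: CkD => //; first exact/Ck_linear/linear_mx_continuous.
    apply: Ck_postcomp => //; first exact: linear_mx_continuous.
    by apply: Ck_precomp => //; exact: linear_mx_continuous.
  - split=> //.
    + apply/seteqP; split=> [_ [M /= NM <-]|y /= Ny]; first by rewrite /= fX.
      by exists (g y); rewrite ?fg //= gX.
    + apply/seteqP; split=> [_ [y /= Ny <-]|M /= NM]; first by rewrite /= gX.
      by exists (f M); rewrite ?gf //= fX.
apply/seteqP; split=> [_ [M [/= NM YM] <-]|y [/= Ny y0]].
  split; rewrite /= ?fX // => j daj; rewrite /f YM subrr linear0.
  case: (splitP j) daj => i ji; first by rewrite ji leqNgt ltn_ord.
  by move=> _; rewrite (_ : j = rshift _ i) ?row_mxEr ?mxE //; apply: val_inj.
exists (g y); rewrite ?fg //=; split; rewrite gX // /g pYj.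
suff -> : yY y = 0 by rewrite add0r.
rewrite /yY (_ : rsubmx y = 0) ?linear0 //.
by apply/rowP => i; rewrite !mxE y0 //= leq_addr.
Qed.

Lemma graph_smooth_submanifold : (a + b)%N = q ->
  smooth_submanifold (d * a) [set M | N (pX M) /\ pY M = h (pX M)].
Proof.
move=> abq; have e : (d * a + d * b = d * q)%N by rewrite -mulnDr abq.
split=> [|M [NM _]]; first by rewrite -e leq_addr.
have [W [f [g [fg fS]]]] := graph_slice_chart e.
exists (pX @^-1` N), W, f, g; split=> //.
rewrite -fS; congr (f @` _); apply/seteqP.
by split=> [M' []|M' [NM' YM']].
Qed.
End Graph.

(** * Farkas lemma and separation from a convex hull *)

Section Farkas.
Variable R : realType.

Lemma self_dot_le0 k (b : 'cV[R]_k) : (b^T *m b) 0 0 <= 0 -> b = 0.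
Proof.
rewrite mxE => sq0; apply/colP => i; rewrite mxE; apply/eqP.
have sq_ge0 j : true -> 0 <= b^T 0 j * b j 0.
  by move=> _; rewrite mxE -expr2 sqr_ge0.
have /eqP : \sum_j b^T 0 j * b j 0 = 0.
  by apply/le_anti; rewrite sq0 sumr_ge0.
rewrite psumr_eq0 // => /allP /(_ i (mem_index_enum _)) /implyP /(_ isT).
by rewrite mxE mulf_eq0 orbb.
Qed.

(** Bartl's induction on the number of generators.  If b is not already implied by
the columns of the remaining matrix, some y1 is nonpositive on them, positive on b
and equal to 1 on the first column g; subtracting from everything its y1-multiple
of g gives a system with one generator fewer. *)
Lemma farkas k n (G : 'M[R]_(k, n)) (b : 'cV[R]_k) :
  (forall y : 'rV[R]_k, (forall i, (y *m G) 0 i <= 0) -> (y *m b) 0 0 <= 0) ->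
  exists2 w : 'cV[R]_n, (forall i, 0 <= w i 0) & G *m w = b.
Proof.
elim: n G b => [|n IH] G b imp.
  exists 0 => [i|]; first by rewrite mxE.
  by rewrite mulmx0; apply/esym/self_dot_le0/imp => -[].
rewrite -[n.+1]/(1 + n)%N in G imp *.
have [imp'|/existsNP[y0 /not_implyP[y0G /negP]]] :=
  pselect (forall y : 'rV[R]_k, (forall i, (y *m rsubmx G) 0 i <= 0) -> (y *m b) 0 0 <= 0).
  have [w w0 Gw] := IH _ _ imp'; exists (col_mx 0 w) => [i|].
    by rewrite mxE; case: splitP => j _; rewrite ?mxE.
  by rewrite -[G]hsubmxK mul_row_col mulmx0 add0r.
rewrite -ltNge => y0b.
pose g := lsubmx G; pose G' := rsubmx G.
have GE (y : 'rV_k) : y *m G = row_mx (y *m g) (y *m G').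
  by rewrite -[G in LHS]hsubmxK mul_mx_row.
pose s := (y0 *m g) 0 0.
have y0g : 0 < s.
  rewrite ltNge; apply/negP => y0g; move: y0b; rewrite ltNge => /negP; apply.
  apply: imp => i; rewrite GE mxE; case: splitP => j _; last exact: y0G.
  by rewrite ord1.
pose y1 := s^-1 *: y0.
have y1g : y1 *m g = 1%:M.
  rewrite [y1 *m g]mx11_scalar -scalemxAl mxE -/s mulVf //.
  by rewrite gt_eqF.
have y1G i : (y1 *m G') 0 i <= 0.
  by rewrite -scalemxAl mxE mulr_ge0_le0 ?invr_ge0 ?(ltW y0g) //; exact: y0G.
have y1b : 0 < (y1 *m b) 0 0.
  by rewrite -scalemxAl mxE mulr_gt0 ?invr_gt0.
have [|w w0 Gw] := IH (G' - g *m (y1 *m G')) (b - g *m (y1 *m b)).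
  move=> y yG; pose z := y - (y *m g) *m y1.
  have -> : y *m (b - g *m (y1 *m b)) = z *m b.
    by rewrite mulmxBr mulmxBl !mulmxA.
  apply: imp => i; rewrite GE mxE; case: splitP => j _.
    by rewrite mulmxBl -(mulmxA _ y1) y1g mulmx1 subrr mxE.
  suff -> : z *m G' = y *m (G' - g *m (y1 *m G')) by exact: yG.
  by rewrite mulmxBr mulmxBl !mulmxA.
pose c := y1 *m b - y1 *m G' *m w.
exists (col_mx c w) => [i|].
  rewrite mxE; case: splitP => j _ //; rewrite ord1 /c.
  have -> : (y1 *m b - y1 *m G' *m w) 0 0 = (y1 *m b) 0 0 - (y1 *m G' *m w) 0 0.
    by rewrite [LHS]mxE; congr (_ + _); rewrite mxE.
  rewrite subr_ge0 (le_trans _ (ltW y1b)) // mxE sumr_le0 // => l _.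
  by rewrite mulr_le0_ge0.
have Gw' : G' *m w = b - g *m (y1 *m b) + g *m (y1 *m G') *m w.
  by rewrite -Gw mulmxBl subrK.
rewrite -[G]hsubmxK mul_row_col -/g -/G' Gw' /c mulmxBr (mulmxA _ _ w).
by rewrite addrC -addrA (addrCA (_ *m w)) subrr addr0 subrK.
Qed.

(** Farkas for the cone over V, the last coordinate being the sum of the weights; the
last coordinate of the separating form becomes the threshold. *)
Lemma conv_separation d n (V : 'M[R]_(d, n)) (x : 'cV[R]_d) : ~ conv_hull V x ->
  exists (c : 'cV[R]_d) beta, (forall i, (c^T *m V) 0 i <= beta) /\ beta < (c^T *m x) 0 0.
Proof.
move=> nVx; apply: contrapT => nsep; apply: nVx.
pose G : 'M[R]_(d + 1, n) := col_mx V (const_mx 1).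
pose b : 'cV[R]_(d + 1) := col_mx x (const_mx 1).
have [|w w0] := @farkas _ _ G b.
  move=> y yV; rewrite leNgt; apply/negP => yx; apply: nsep.
  have yE p (U : 'M_(d, p)) : y *m col_mx U (const_mx 1 : 'rV_p) =
      lsubmx y *m U + const_mx (rsubmx y 0 0).
    rewrite -[y in LHS]hsubmxK mul_row_col; congr (_ + _).
    by apply/rowP => i; rewrite !mxE big_ord1 !mxE mulr1.
  exists (lsubmx y)^T, (- rsubmx y 0 0); rewrite trmxK; split=> [i|].
    by have := yV i; rewrite yE 2!mxE [const_mx _ _ _]mxE -lerBrDr sub0r.
  by move: yx; rewrite yE 2!mxE [const_mx _ _ _]mxE -ltrBlDr sub0r.
rewrite mul_col_mx => /eq_col_mx[Vw w1]; exists w => //; split=> //.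
move/matrixP/(_ 0 0): w1; rewrite !mxE => <-.
by apply: eq_bigr => i _; rewrite mxE mul1r.
Qed.

End Farkas.

(** * Convex hulls and polar duality *)

Section Averages.
Variables (R : realType) (n : nat) (w p : 'I_n -> R) (b : R).
Hypotheses (w_ge0 : forall i, 0 <= w i) (w_sum : \sum_i w i = 1).

Let b_avg : b = \sum_i b * w i.
Proof. by rewrite -mulr_sumr w_sum mulr1. Qed.

Lemma avg_le : (forall i, p i <= b) -> \sum_i p i * w i <= b.
Proof.
by move=> pb; rewrite [leRHS]b_avg ler_sum // => i _; rewrite ler_wpM2r.
Qed.

Lemma avg_eq : (forall i, w i != 0 -> p i = b) -> \sum_i p i * w i = b.
Proof.
move=> pb; rewrite [RHS]b_avg; apply: eq_bigr => i _.
by have [->|/pb ->] := eqVneq (w i) 0; rewrite ?mulr0.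
Qed.

Lemma avg_max i : (forall i, p i <= b) -> \sum_i p i * w i = b ->
  w i != 0 -> p i = b.
Proof.
move=> pb sb wi.
have gap_ge0 j : true -> 0 <= (b - p j) * w j.
  by move=> _; rewrite mulr_ge0 // subr_ge0.
have /eqP : \sum_j (b - p j) * w j = 0.
  under eq_bigr do rewrite mulrBl.
  by rewrite sumrB -b_avg sb subrr.
rewrite psumr_eq0 // => /allP /(_ i (mem_index_enum _)) /implyP /(_ isT).
by rewrite mulf_eq0 (negbTE wi) orbF subr_eq0 => /eqP.
Qed.

Lemma avg_supp : exists i, w i != 0.
Proof.
apply: contrapT => /forallNP w0; move/eqP: w_sum.
rewrite big1 ?(eq_sym 0) ?oner_eq0 // => i _; apply/eqP.
by apply: contrapT => wi; apply: (w0 i); apply/negP.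
Qed.

End Averages.

Section ConvexHulls.
Variable R : realType.

Lemma conv_col d n (V : 'M[R]_(d, n)) i : conv_hull V (col i V).
Proof.
exists (delta_mx i 0); last by rewrite colE.
split=> [j|]; first by rewrite /= mxE ler0n.
rewrite (bigD1 i) //= big1 => [|j ji]; rewrite !mxE ?eqxx ?addr0 //.
by rewrite (negbTE ji).
Qed.

Lemma mul_col_entry d n m (C : 'M[R]_(m, d)) (V : 'M[R]_(d, n)) i j :
  (C *m col i V) j 0 = (C *m V) j i.
Proof. by rewrite !mxE; apply: eq_bigr => k _; rewrite mxE. Qed.

Lemma mul_conv_entry d n m (C : 'M[R]_(m, d)) (V : 'M[R]_(d, n)) w j :
  (C *m (V *m w)) j 0 = \sum_i (C *m V) j i * w i (0 : 'I_1).
Proof. by rewrite mulmxA mxE. Qed.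

Lemma conv_le d n m (C : 'M[R]_(m, d)) (V : 'M[R]_(d, n)) x j b :
  conv_hull V x -> (forall i, (C *m V) j i <= b) -> (C *m x) j 0 <= b.
Proof. by move=> [w [w0 w1] <-] Vb; rewrite mul_conv_entry avg_le. Qed.

Lemma conv_no_ray d n (V : 'M[R]_(d, n)) c :
  (forall s, 0 <= s -> conv_hull V (s *: c)) -> c = 0.
Proof.
move=> ray; apply: self_dot_le0; rewrite leNgt; apply/negP => cc.
pose M := \sum_i `|(c^T *m V) 0 i|.
have M0 : 0 <= M by apply: sumr_ge0.
have s0 : 0 <= (M + 1) / (c^T *m c) 0 0 by rewrite divr_ge0 ?addr_ge0 // ltW.
have : (c^T *m (((M + 1) / (c^T *m c) 0 0) *: c)) 0 0 <= M.
  apply: (conv_le (ray _ s0)) => i; apply: le_trans (ler_norm _) _.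
  by rewrite /M (bigD1 i) //= lerDl sumr_ge0.
rewrite -scalemxAr mxE divfK ?gt_eqF // -lerBrDl subrr.
by rewrite ler10.
Qed.

(** A supporting form that is maximal at a convex combination is maximal at each point
that takes part in it. *)
Lemma face_supp d n (V : 'M[R]_(d, n)) F (w : 'cV[R]_n) i :
  face (conv_hull V) F -> (forall i, 0 <= w i 0) -> \sum_i w i 0 = 1 ->
  F (V *m w) -> w i 0 != 0 -> F (col i V).
Proof.
move=> [c [b [Vb ->]]] w0 w1 [_ /= Fw] wi; split; first exact: conv_col.
rewrite /= mul_col_entry; apply: (avg_max w0 w1 _ _ wi).
  by move=> j; rewrite -mul_col_entry; apply: Vb; apply: conv_col.
by rewrite -mul_conv_entry.
Qed.

Lemma face_has_vertex d n (V : 'M[R]_(d, n)) F x :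
  face (conv_hull V) F -> F x -> exists i, F (col i V).
Proof.
move=> fF Fx; have [w [w0 w1] wx] : conv_hull V x.
  by case: fF Fx => c [b [_ ->]] [].
have [i wi] := avg_supp w1; exists i; apply: face_supp fF w0 w1 _ wi.
by rewrite wx.
Qed.

(** The finitely many slack inequalities leave room for a common step length, and along
q the tight ones do not increase. *)
Lemma small_step (I : finType) (p q : I -> R) :
  (forall i, p i <= 1) -> (forall i, p i = 1 -> q i <= 0) ->
  exists2 t, 0 < t & forall i, p i + t * q i <= 1.
Proof.
move=> p1 q0; pose f i := if p i < 1 then (1 - p i) / (1 + `|q i|) else 1.
have q1 i : 0 < 1 + `|q i| by rewrite ltr_pwDl.
have f0 i : 0 < f i.
  by rewrite /f; case: ifP => // pi; rewrite divr_gt0 // subr_gt0.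
pose t := \big[Num.min/1]_i f i.
have t0 : 0 < t by rewrite /t; elim/big_rec: _ => // i x _ x0; rewrite lt_min f0.
exists t => // i; have := p1 i; rewrite le_eqVlt => /predU1P[pi|pi].
  by rewrite pi gerDl mulr_ge0_le0 ?q0 // ltW.
have tf : t <= (1 - p i) / (1 + `|q i|).
  have : t <= f i by apply: bigmin_le_cond.
  by rewrite /f pi.
rewrite -lerBrDl; apply: le_trans (_ : t * (1 + `|q i|) <= _).
  by rewrite ler_pM2l // (le_trans (ler_norm _)) // lerDr.
by rewrite -ler_pdivlMr.
Qed.

End ConvexHulls.

Section DualPairs.
Variable R : realType.
Implicit Types d n m : nat.

Definition dual_pair d n m (V : 'M[R]_(d, n)) (A : 'M[R]_(d, m)) :=
  conv_hull V = [set x | forall j, (A^T *m x) j 0 <= 1].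

Lemma dual_pairP d n m (V : 'M[R]_(d, n)) (A : 'M[R]_(d, m)) x :
  dual_pair V A -> conv_hull V x <-> forall j, (A^T *m x) j 0 <= 1.
Proof. by move=> ->. Qed.

Lemma dual_pair_le d n m (V : 'M[R]_(d, n)) (A : 'M[R]_(d, m)) i j :
  dual_pair V A -> (A^T *m V) j i <= 1.
Proof.
move=> VA; rewrite -mul_col_entry.
by apply: (dual_pairP _ VA).1; apply: conv_col.
Qed.

Lemma mul_tr_sym d n m (V : 'M[R]_(d, n)) (A : 'M[R]_(d, m)) i j :
  (V^T *m A) i j = (A^T *m V) j i.
Proof.
have -> : V^T *m A = (A^T *m V)^T by rewrite trmx_mul trmxK.
by rewrite [LHS]mxE.
Qed.

Lemma dual_pair_no_ray d n m (V : 'M[R]_(d, n)) (A : 'M[R]_(d, m)) (x : 'cV[R]_d) :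
  dual_pair V A -> (forall j, (A^T *m x) j 0 <= 0) -> x = 0.
Proof.
move=> VA Ax; apply: (@conv_no_ray _ _ _ V) => s s0; apply/(dual_pairP _ VA) => j.
by rewrite -scalemxAr mxE (le_trans _ ler01) // mulr_ge0_le0.
Qed.

Lemma dual_pair_rows d n m (V : 'M[R]_(d, n)) (A : 'M[R]_(d, m)) :
  (0 < d)%N -> dual_pair V A -> (0 < m)%N.
Proof.
move=> d0 VA; rewrite lt0n; apply/eqP => m0.
have one0 : (const_mx 1 : 'cV[R]_d) = 0.
  apply: (dual_pair_no_ray VA) => j.
  by case: j => j jm; exfalso; rewrite m0 in jm.
move/matrixP/(_ (Ordinal d0) 0)/eqP: one0.
by rewrite !mxE oner_eq0.
Qed.

(** Polarity.  If y satisfies V^T y <= 1 but is separated from conv A by c, then either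
c can be scaled into the polyhedron A^T x <= 1, where it contradicts V^T y <= 1, or
c is a direction in which that polyhedron is unbounded.  In dimension 0 the statement
fails for m = 0. *)
Lemma dual_pair_sym d n m (V : 'M[R]_(d, n)) (A : 'M[R]_(d, m)) :
  (0 < d)%N -> dual_pair V A -> dual_pair A V.
Proof.
move=> d0 VA; apply/seteqP; split=> y.
  move=> Ay i; apply: conv_le Ay _ => j; rewrite mul_tr_sym.
  exact: dual_pair_le.
move=> /= Vy; apply: contrapT => /conv_separation[c [b [cA cy]]].
have Ac j : (A^T *m c) j 0 <= b by rewrite mul_tr_sym.
have [cy0|cy0] := leP ((c^T *m y) 0 0) 0.
  have c0 : c = 0.
    apply: dual_pair_no_ray VA _ => j; apply: le_trans (Ac j) _.
    exact: le_trans (ltW cy) cy0.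
  have := dual_pair_rows d0 VA; rewrite lt0n => /eqP m0.
  have [j _] : exists j : 'I_m, true.
    by move: m0; case: (m) => // m' _; exists ord0.
  by have := Ac j; rewrite c0 mulmx0 mxE leNgt => /negP; apply;
     move: cy; rewrite c0 linear0 mul0mx mxE.
(* A positive number between all the c . a_j and c . y; b itself may be negative. *)
pose t := Num.max b ((c^T *m y) 0 0 / 2).
have t0 : 0 < t by rewrite lt_max divr_gt0 ?orbT.
have ty : t < (c^T *m y) 0 0.
  by rewrite gt_max cy /= ltr_pdivrMr // ltr_pMr // ltr1n.
have Vc : conv_hull V (t^-1 *: c).
  apply/(dual_pairP _ VA) => j; rewrite -scalemxAr mxE mulrC ler_pdivrMr // mul1r.
  by rewrite (le_trans (Ac j)) // le_max lexx.
have : (y^T *m (t^-1 *: c)) 0 0 <= 1.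
  by apply: (conv_le Vc) => i; rewrite mul_tr_sym; apply: Vy.
apply/negP; rewrite -ltNge -scalemxAr mxE mul_tr_sym mulrC.
by rewrite ltr_pdivlMr // mul1r.
Qed.

End DualPairs.

(** * Faces as sets of tight inequalities *)

Section Faces.
Variable R : realType.

Lemma mul_addZ_entry d m (C : 'M[R]_(m, d)) (x u : 'cV[R]_d) t j :
  (C *m (x + t *: u)) j 0 = (C *m x) j 0 + t * (C *m u) j 0.
Proof. by rewrite mulmxDr -scalemxAr [LHS]mxE; congr (_ + _); rewrite mxE. Qed.

Definition inc d n m (V : 'M[R]_(d, n)) (A : 'M[R]_(d, m)) (i : 'I_n) : set 'I_m :=
  [set j | (A^T *m V) j i = 1].

Definition tight d m (A : 'M[R]_(d, m)) (F : set 'cV[R]_d) : set 'I_m :=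
  [set j | forall x, F x -> (A^T *m x) j 0 = 1].

Definition tface d n m (V : 'M[R]_(d, n)) (A : 'M[R]_(d, m)) (T : set 'I_m) :=
  conv_hull V `&` [set x | forall j, T j -> (A^T *m x) j 0 = 1].

(** For the columns of V this says that they are pairwise distinct vertices; for the
swapped pair (A, V) it says that the inequalities define pairwise distinct facets. *)
Definition inc_antichain d n m (V : 'M[R]_(d, n)) (A : 'M[R]_(d, m)) :=
  forall i l, inc V A i `<=` inc V A l -> l = i.

Definition same_inc d n m (V V' : 'M[R]_(d, n)) (A A' : 'M[R]_(d, m)) :=
  forall i j, (A^T *m V) j i = 1 <-> (A'^T *m V') j i = 1.

Section OnePair.
Variables (d n m : nat) (V : 'M[R]_(d, n)) (A : 'M[R]_(d, m)).
Hypothesis VA : dual_pair V A.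

(** The sum of the inequalities in T supports exactly this set. *)
Lemma tface_face T : face (conv_hull V) (tface V A T).
Proof.
(* The indicator of T, so that A t is the sum of the forms in T. *)
pose t : 'cV[R]_m := \col_j (`[< T j >])%:R.
have cE x : ((A *m t)^T *m x) 0 0 = \sum_j t j 0 * (A^T *m x) j 0.
  by rewrite trmx_mul -mulmxA mxE; apply: eq_bigr => j _; rewrite mxE.
have t0 j : 0 <= t j 0 by rewrite mxE ler0n.
exists (A *m t), (\sum_j t j 0); split=> [x Vx|].
  rewrite cE ler_sum // => j _; rewrite ler_piMr //.
  exact: (dual_pairP x VA).1.
apply/seteqP; split=> x [Vx Tx]; split=> //=.
  rewrite cE; apply: eq_bigr => j _; rewrite mxE.
  by case: asboolP => Tj; rewrite ?mul0r // Tx // mulr1.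
move=> j Tj.
have gap_ge0 l : true -> 0 <= t l 0 * (1 - (A^T *m x) l 0).
  by move=> _; rewrite mulr_ge0 // subr_ge0; exact: (dual_pairP x VA).1.
have /eqP : \sum_l t l 0 * (1 - (A^T *m x) l 0) = 0.
  under eq_bigr do rewrite mulrBr mulr1.
  by rewrite sumrB -cE Tx subrr.
rewrite psumr_eq0 // => /allP /(_ j (mem_index_enum _)) /implyP /(_ isT).
by rewrite mxE asboolT // mul1r subr_eq0 eq_sym => /eqP.
Qed.

Lemma face_sub_conv F : face (conv_hull V) F -> F `<=` conv_hull V.
Proof. by move=> [c [b [_ ->]]] x []. Qed.

(** A nonempty proper face has a supporting form scaled to c x <= 1, which by polarity
is a convex combination of the facet forms; those with nonzero weight are tight
on the face, and conversely force c x = 1.  The empty face is cut out by all the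
inequalities, because a common solution x would make -x a ray of the polytope. *)
Lemma face_tface F : (0 < d)%N -> face (conv_hull V) F -> F = tface V A (tight A F).
Proof.
move=> d0 fF; apply/seteqP; split=> [x Fx|x [Vx Tx]].
  by split=> [|j]; [exact: face_sub_conv fF _ Fx|apply].
have [[x0 Fx0]|noF] := pselect (exists x0, F x0); last first.
  (* On the empty set every inequality is vacuously tight, hence tight at x. *)
  have allT j : (A^T *m x) j 0 = 1.
    by apply: Tx => y Fy; case: noF; exists y.
  have m0 := dual_pair_rows d0 VA.
  have x0 : - x = 0.
    by apply: dual_pair_no_ray VA _ => j; rewrite mulmxN mxE allT oppr_le0 ler01.
  have /eqP := allT (Ordinal m0).
  by rewrite -(opprK x) x0 oppr0 mulmx0 mxE eq_sym oner_eq0.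
case: (fF) => c [b [Vb FE]]; rewrite FE; split=> //=.
have V0 : conv_hull V 0.
  by apply/(dual_pairP _ VA) => j; rewrite mulmx0 mxE ler01.
have b0 : 0 <= b by have := Vb 0 V0; rewrite mulmx0 mxE.
have [cz|/eqP cnz] := eqVneq c 0.
  have : (c^T *m x0) 0 0 = b by move: Fx0; rewrite FE => -[].
  by rewrite cz linear0 !mul0mx.
have {b0} b0 : 0 < b.
  have [t t0 tA] := @small_step R _ (fun=> 0) (fun j => (A^T *m c) j 0)
    (fun=> ler01) (fun j e => False_ind _ (elimN eqP (oner_neq0 _) (esym e))).
  have Vtc : conv_hull V (t *: c).
    apply/(dual_pairP _ VA) => j; rewrite -scalemxAr mxE -[_ * _]add0r.
    exact: tA.
  rewrite lt_neqAle b0 andbT eq_sym; apply/eqP => bz; apply: cnz.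
  apply: self_dot_le0; have := Vb _ Vtc.
  by rewrite bz -scalemxAr mxE pmulr_rle0.
have [w [w0 w1] wc] : conv_hull A (b^-1 *: c).
  apply/(dual_pairP _ (dual_pair_sym d0 VA)) => i.
  rewrite mul_tr_sym linearZ -scalemxAl mxE mulrC ler_pdivrMr // mul1r.
  by rewrite -mul_col_entry; apply: Vb; apply: conv_col.
have bn0 : b != 0 by rewrite gt_eqF.
have cE (x' : 'cV[R]_d) : (c^T *m x') 0 0 = b * \sum_j (A^T *m x') j 0 * w j 0.
  rewrite -[c](scalerKV bn0) -wc linearZ -scalemxAl mxE; congr (_ * _).
  by rewrite -mul_tr_sym mul_conv_entry; apply: eq_bigr => j _; rewrite mul_tr_sym.
rewrite cE (avg_eq (b := 1) w1) ?mulr1 // => j wj; apply: Tx => y Fy.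
apply: (avg_max w0 w1 (p := fun j => (A^T *m y) j 0)) wj.
  by move=> l; apply: (dual_pairP y VA).1; apply: face_sub_conv fF _ Fy.
have : (c^T *m y) 0 0 = b by move: Fy; rewrite FE => -[].
by rewrite cE -{2}[b]mulr1 => /(mulfI bn0).
Qed.

Lemma tight_vertices m' (C : 'M[R]_(d, m')) F j : face (conv_hull V) F ->
  tight C F j <-> forall i, F (col i V) -> (C^T *m V) j i = 1.
Proof.
move=> fF; split=> [Fj i Fi|Fj x Fx]; first by rewrite -mul_col_entry Fj.
have [w [w0 w1] wx] := face_sub_conv fF Fx.
rewrite -wx mul_conv_entry; apply: avg_eq => // i wi; apply: Fj.
by apply: face_supp fF w0 w1 _ wi; rewrite wx.
Qed.

Lemma face_single F i x : face (conv_hull V) F ->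
  (forall l, F (col l V) -> l = i) -> F x -> x = col i V.
Proof.
move=> fF Fi Fx; have [w [w0 w1] wx] := face_sub_conv fF Fx.
have wl l : l != i -> w l 0 = 0.
  move=> li; apply/eqP; apply: contraNT li => wl; apply/eqP/Fi.
  by apply: face_supp fF w0 w1 _ wl; rewrite wx.
rewrite -wx colE; congr (_ *m _); apply/colP => l; rewrite !mxE eqxx andbT.
have [->|/wl //] := eqVneq l i.
by rewrite -w1 (bigD1 i) //= big1 ?addr0 // => l' /wl.
Qed.

Lemma antichain_tface i : inc_antichain V A -> tface V A (inc V A i) = [set col i V].
Proof.
move=> sep; apply/seteqP; split=> [x Tx|_ ->].
  apply: face_single (tface_face _) _ Tx => l [_ /= Tl]; apply: sep => j ij.
  by have := Tl j ij; rewrite mul_col_entry.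
by split=> [|j ij]; [exact: conv_col|rewrite mul_col_entry].
Qed.

Lemma antichain_inj i l : inc_antichain V A -> col i V = col l V -> i = l.
Proof.
move=> sep il; apply: sep => j; rewrite /inc /=.
by rewrite -(mul_col_entry _ _ i) il mul_col_entry.
Qed.

(** If u were orthogonal to all facet forms through v_i, a small move from v_i along u
would stay in the polytope and in the face that is the single point v_i. *)
Lemma antichain_span i (u : 'cV[R]_d) : inc_antichain V A ->
  (forall j, inc V A i j -> (A^T *m u) j 0 = 0) -> u = 0.
Proof.
move=> sep iu.
have [t t0 tA] : exists2 t, 0 < t &
    forall j, (A^T *m V) j i + t * (A^T *m u) j 0 <= 1.
  apply: small_step => [j|j ij]; first exact: dual_pair_le.
  by rewrite iu.
have : tface V A (inc V A i) (col i V + t *: u).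
  split=> [|j ij].
    apply/(dual_pairP _ VA) => j.
    by rewrite mul_addZ_entry mul_col_entry.
  by rewrite mul_addZ_entry mul_col_entry iu // mulr0 addr0.
rewrite antichain_tface // => /eqP; rewrite -subr_eq0 addrC addKr scaler_eq0.
by rewrite gt_eqF //= => /eqP.
Qed.

End OnePair.
End Faces.

(** * Transfer of faces and stability of simple incidences *)

Section Transfer.
Variables (R : realType) (d n m : nat).
Implicit Types (V : 'M[R]_(d, n)) (A : 'M[R]_(d, m)).
Hypothesis d0 : (0 < d)%N.

(** A face is determined by its tight inequalities, so these carry it over to any other
pair with as many inequalities. *)
Definition transfer V' A' A (F : set 'cV[R]_d) : set 'cV[R]_d :=
  tface V' A' (tight A F).

Lemma same_inc_sym V V' A A' : same_inc V V' A A' -> same_inc V' V A' A.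
Proof. by move=> s i j; split=> /s. Qed.

Lemma same_incE V V' A A' i : same_inc V V' A A' -> inc V A i = inc V' A' i.
Proof. by move=> s; apply/seteqP; split=> j /s. Qed.

Lemma same_inc_antichain V V' A A' : same_inc V V' A A' ->
  inc_antichain V A -> inc_antichain V' A'.
Proof. by move=> s sep i l; rewrite -!(same_incE _ s) => /sep. Qed.

(** Tightness on a face is tested at its vertices, and there it is a matter of
incidence. *)
Lemma tight_transfer V V' A A' F : dual_pair V A -> dual_pair V' A' ->
  same_inc V V' A A' -> face (conv_hull V) F ->
  tight A' (transfer V' A' A F) = tight A F.
Proof.
move=> VA VA' s fF; apply/seteqP; split=> j; last by move=> Fj x [_]; apply.
move=> Fj; apply/(tight_vertices _ _ fF) => i Fi.
apply/s; rewrite -mul_col_entry; apply: Fj; split=> [|l Fl]; first exact: conv_col.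
by rewrite mul_col_entry; apply/s; move/(tight_vertices _ _ fF): Fl; apply.
Qed.

Lemma transferK V V' A A' F : dual_pair V A -> dual_pair V' A' ->
  same_inc V V' A A' -> face (conv_hull V) F ->
  transfer V A A' (transfer V' A' A F) = F.
Proof.
move=> VA VA' s fF; rewrite {1}/transfer (tight_transfer VA VA' s fF).
by rewrite -face_tface.
Qed.

Lemma transfer_mono V' A' A F G : F `<=` G ->
  transfer V' A' A F `<=` transfer V' A' A G.
Proof. by move=> FG x [Vx Fx]; split=> // j Gj; apply: Fx => y /FG /Gj. Qed.

Lemma transfer_face V' A' A F : dual_pair V' A' ->
  face (conv_hull V') (transfer V' A' A F).
Proof. by move=> VA'; apply: tface_face. Qed.

Lemma transfer_sub V V' A A' F G : dual_pair V A -> dual_pair V' A' ->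
  same_inc V V' A A' -> face (conv_hull V) F -> face (conv_hull V) G ->
  transfer V' A' A F `<=` transfer V' A' A G <-> F `<=` G.
Proof.
move=> VA VA' s fF fG; split=> [FG|]; last exact: transfer_mono.
rewrite -(transferK VA VA' s fF) -(transferK VA VA' s fG).
exact: transfer_mono.
Qed.

Lemma transfer_bij V V' A A' : dual_pair V A -> dual_pair V' A' ->
  same_inc V V' A A' ->
  set_bij (face (conv_hull V)) (face (conv_hull V')) (transfer V' A' A).
Proof.
move=> VA VA' s; split=> [F fF|F G|F' fF']; first exact: transfer_face.
  rewrite !inE => fF fG FG.
  by rewrite -(transferK VA VA' s fF) FG transferK.
exists (transfer V A A' F'); first exact: transfer_face.
by apply: transferK => //; apply: same_inc_sym.
Qed.

Lemma transfer_vertex V V' A A' i : dual_pair V A -> dual_pair V' A' ->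
  same_inc V V' A A' -> inc_antichain V A ->
  transfer V' A' A [set col i V] = [set col i V'].
Proof.
move=> VA VA' s sep.
rewrite -(antichain_tface VA' _ (same_inc_antichain s sep)) -(same_incE _ s).
rewrite /transfer; congr (tface _ _ _); apply/seteqP; split=> j.
  by move=> /(_ _ erefl); rewrite mul_col_entry.
by move=> ij _ ->; rewrite mul_col_entry.
Qed.

Lemma transfer_facet V V' A A' j : dual_pair V A -> dual_pair V' A' ->
  same_inc V V' A A' ->
  transfer V' A' A (tface V A [set j]) = tface V' A' [set j].
Proof.
move=> VA VA' s; apply/seteqP; split=> x [Vx Tx]; split=> // l.
  by move=> ->; apply: Tx => y [_]; apply.
move=> Fl; suff : tight A' (tface V' A' [set j]) l by apply; split.
apply/(tight_vertices _ _ (tface_face VA' _)) => i [_ /= ij].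
apply/s; move/(tight_vertices _ _ (tface_face VA _)): Fl; apply.
split=> [|_ ->]; first exact: conv_col.
by rewrite mul_col_entry; apply/s; rewrite -mul_col_entry; apply: ij.
Qed.

End Transfer.

Section Bases.
Variable R : realType.

Lemma colsub_mul_entry d m k p (A : 'M[R]_(d, m)) (e : 'I_k -> 'I_m)
    (Y : 'M[R]_(d, p)) i l :
  ((colsub e A)^T *m Y) i l = (A^T *m Y) (e i) l.
Proof. by rewrite !mxE; apply: eq_bigr => j _; rewrite !mxE. Qed.

(** Zeroing the vectors outside J leaves a matrix of full rank d; any d independent
rows of it must come from J. *)
Lemma spanning_basis d m (A : 'M[R]_(d, m)) (J : set 'I_m) :
  (forall u : 'cV[R]_d, (forall j, J j -> (A^T *m u) j 0 = 0) -> u = 0) ->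
  exists e : 'I_d -> 'I_m,
    [/\ injective e, forall k, J (e k) & colsub e A \in unitmx].
Proof.
move=> span.
pose B : 'M[R]_(m, d) := \matrix_(j, k) if `[< J j >] then A k j else 0.
have Bfull : row_full B.
  rewrite -col_leq_rank -mxrank_tr -[X in (X <= _)%N]/d.
  suff : row_free B^T by rewrite /row_free => /eqP ->.
  apply: inj_row_free => v vB; apply: trmx_inj; rewrite trmx0.
  apply: span => j Jj; move/matrixP/(_ 0 j): vB; rewrite !mxE => vB.
  by rewrite -[RHS]vB; apply: eq_bigr => k _; rewrite !mxE asboolT // mulrC.
pose e := fullrankfun Bfull.
have eU : rowsub e B \in unitmx by rewrite -row_full_unit fullrowsub_full.
have Je k : J (e k).
  apply: contrapT => nJ.
  have Bk : row k (rowsub e B) = 0.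
    by apply/rowP => l; rewrite !mxE asboolF.
  have : row k (rowsub e B *m invmx (rowsub e B)) = 0.
    by rewrite row_mul Bk mul0mx.
  rewrite mulmxV // => /rowP/(_ k)/eqP.
  by rewrite !mxE eqxx oner_eq0.
exists e; split=> //; first exact: fullrankfun_inj.
suff -> : colsub e A = (rowsub e B)^T by rewrite unitmx_tr.
by apply/matrixP => k l; rewrite !mxE asboolT.
Qed.

End Bases.

Section Simple.
Variables (R : realType) (d n m : nat).
Variables (V : 'M[R]_(d, n)) (A : 'M[R]_(d, m)) (e : 'I_n -> 'I_d -> 'I_m).
Hypothesis e_unit : forall i, colsub (e i) A \in unitmx.

(** Moving slightly from v_i along the edge that leaves facet k gives a point x on all
other facets of i but off k.  Writing x as a convex combination, its vertices lie on
the same facets, and one of them is off k. *)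
Lemma vertex_neighbor i k : dual_pair V A ->
  (forall j, inc V A i j <-> exists k, j = e i k) ->
  exists2 l, (A^T *m V) (e i k) l < 1 &
    forall k', k' != k -> (A^T *m V) (e i k') l = 1.
Proof.
move=> VA eE.
(* The edge direction: a_(e i k') . u = - delta_(k', k). *)
pose u := - (invmx (colsub (e i) A)^T *m delta_mx k (0 : 'I_1)).
have uE k' : (A^T *m u) (e i k') 0 = - (k' == k)%:R.
  rewrite -colsub_mul_entry mulmxN mulKVmx ?unitmx_tr //.
  by rewrite !mxE andbT.
have [t t0 tA] : exists2 t, 0 < t &
    forall j, (A^T *m V) j i + t * (A^T *m u) j 0 <= 1.
  apply: small_step => [j|j /eE[k' ->]]; first exact: dual_pair_le.
  by rewrite uE oppr_le0 ler0n.
pose x := col i V + t *: u.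
have xE j : (A^T *m x) j 0 = (A^T *m V) j i + t * (A^T *m u) j 0.
  by rewrite mul_addZ_entry mul_col_entry.
have Vx : conv_hull V x by apply/(dual_pairP _ VA) => j; rewrite xE.
have xe k' : (A^T *m x) (e i k') 0 = 1 - t * (k' == k)%:R.
  by rewrite xE uE mulrN; congr (_ - _); apply/eE; exists k'.
pose T := [set j | exists2 k', k' != k & j = e i k'].
have Tx : tface V A T x.
  by split=> // j [k' k'k ->]; rewrite xe (negbTE k'k) mulr0 subr0.
have [w [w0 w1] wx] := Vx.
have [l wl lk] : exists2 l, w l 0 != 0 & (A^T *m V) (e i k) l < 1.
  apply: contrapT => nl.
  have := xe k; rewrite -wx mul_conv_entry (avg_eq (b := 1) w1) => [/eqP|l wl].
    by rewrite eqxx mulr1 eq_sym -subr_eq0 addrAC subrr add0r oppr_eq0 gt_eqF.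
  apply/eqP; rewrite eq_le (dual_pair_le _ _ VA) /= leNgt; apply/negP => lk.
  by apply: nl; exists l.
exists l => // k' k'k.
have [_ Tl] : tface V A T (col l V).
  by apply: (face_supp (tface_face VA _)) w0 w1 _ wl; rewrite wx.
by rewrite -mul_col_entry; apply: Tl; exists k'.
Qed.

(** Optimality criterion of the simplex method: at a maximizing vertex i, the form c has
coordinates lam in the basis of facet forms through i, and comparing with the neighbor
opposite to k gives lam_k >= 0, so c is bounded on the whole polyhedron by its value
at v_i. *)
Lemma dual_pair_of_neighbors : (0 < n)%N ->
  (forall i j, (A^T *m V) j i <= 1) ->
  (forall i k, (A^T *m V) (e i k) i = 1) ->
  (forall i k, exists2 l, (A^T *m V) (e i k) l < 1 &
    forall k', k' != k -> (A^T *m V) (e i k') l = 1) ->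
  dual_pair V A.
Proof.
move=> n0 le1 eq1 nb; apply/seteqP; split=> [x Vx j|x Ax].
  by apply: conv_le Vx _.
apply: contrapT => /conv_separation[c [b [cV]]]; apply/negP; rewrite -leNgt.
have [i0 _] : exists i0 : 'I_n, true by exists (Ordinal n0).
have [i _ imax] := @Order.TotalTheory.arg_maxP _ _ _ i0 xpredT
  (fun i => (c^T *m V) 0 i) isT.
pose lam := invmx (colsub (e i) A) *m c.
have cE p (Y : 'M[R]_(d, p)) l :
    (c^T *m Y) 0 l = \sum_k lam k 0 * (A^T *m Y) (e i k) l.
  rewrite -[c in LHS](mulKVmx (e_unit i)) -/lam trmx_mul -mulmxA mxE.
  by apply: eq_bigr => k _; rewrite colsub_mul_entry mxE.
have lam0 k : 0 <= lam k 0.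
  have [l lk lk'] := nb i k; have /= := imax l isT; rewrite -subr_ge0 !cE -sumrB.
  rewrite (bigD1 k) //= big1 ?addr0 => [|k' k'k]; last by rewrite eq1 lk' // subrr.
  by rewrite eq1 -mulrBr pmulr_lge0 // subr_gt0.
apply: le_trans (cV i); rewrite !cE ler_sum // => k _.
by rewrite ler_wpM2l // eq1.
Qed.

End Simple.

(** * Dimensions of polytopes and facets *)

Section Dimension.
Variable R : realType.

Lemma unitmx_inj d (W : 'M[R]_d) :
  (forall w : 'cV[R]_d, W *m w = 0 -> w = 0) -> W \in unitmx.
Proof.
move=> Winj; rewrite -unitmx_tr -row_free_unit; apply: inj_row_free => v vW.
apply: trmx_inj; rewrite trmx0; apply: Winj.
by apply: trmx_inj; rewrite trmx_mul trmxK vW trmx0.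
Qed.

(** Affine coordinates with respect to U embed the columns of W as affinely independent,
hence (all coordinate sums being 1) linearly independent, vectors of R^s. *)
Lemma aff_indep_leq d r s (W : 'M[R]_(d, r)) (U : 'M[R]_(d, s)) :
  aff_indep W -> (forall j, aff_hull U (col j W)) -> (r <= s)%N.
Proof.
move=> Wi WU.
have [X XE] : {X : 'I_r -> 'cV[R]_s &
    forall j, \sum_i X j i 0 = 1 /\ U *m X j = col j W}.
  apply: (@choice _ _ (fun j (x : 'cV[R]_s) => \sum_i x i 0 = 1 /\ U *m x = col j W)) => j.
  by have [x x1 xW] := WU j; exists x.
pose Y : 'M[R]_(s, r) := \matrix_(i, j) X j i 0.
have UY : U *m Y = W.
  apply/matrixP => i j; have [_ /matrixP/(_ i 0)] := XE j.
  by rewrite !mxE => <-; apply: eq_bigr => k _; rewrite mxE.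
suff : row_free Y^T by rewrite /row_free => /eqP <-; apply: rank_leq_col.
apply: inj_row_free => v vY.
have Yv : Y *m v^T = 0 by apply: trmx_inj; rewrite trmx_mul trmxK vY trmx0.
apply: trmx_inj; rewrite trmx0; apply: Wi; first by rewrite -UY -mulmxA Yv mulmx0.
transitivity (\sum_j \sum_i Y i j * v^T j 0).
  apply: eq_bigr => j _; rewrite -mulr_suml -[LHS]mul1r; congr (_ * _).
  by have [<- _] := XE j; apply: eq_bigr => i _; rewrite mxE.
rewrite exchange_big big1 //= => i _.
by move/matrixP/(_ i 0): Yv; rewrite !mxE.
Qed.

Section OnePair.
Variables (d n m : nat) (V : 'M[R]_(d, n)) (A : 'M[R]_(d, m)).
Hypotheses (d0 : (0 < d)%N) (VA : dual_pair V A).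

(** The origin is interior, so a small simplex 0, t e_1, ..., t e_d fits in the polytope. *)
Lemma dual_pair_dim : has_dim (conv_hull V) d%:Z.
Proof.
have [t t0 tA] : exists2 t, 0 < t &
    forall jk : 'I_m * 'I_d, 0 + t * A jk.2 jk.1 <= 1.
  by apply: small_step => jk; rewrite ?ler01 // => /esym/eqP; rewrite oner_eq0.
have tn0 : t != 0 by rewrite gt_eqF.
have tAj j k : (A^T *m (t *: delta_mx k (0 : 'I_1))) j 0 <= 1.
  rewrite -scalemxAr -colE !mxE.
  by have := tA (j, k); rewrite add0r.
exists (1 + d)%N, (row_mx (0 : 'cV_d) t%:M); split.
- by rewrite PoszD addrAC subrr add0r.
- move=> w; rewrite -[w]vsubmxK mul_row_col mul0mx add0r mul_scalar_mx.
  move/eqP; rewrite scaler_eq0 (negbTE tn0) /= => /eqP ->.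
  rewrite big_split_ord /= big_ord1 col_mxEu big1 ?addr0 => [w0|k _].
    apply/colP => i; rewrite !mxE; case: splitP => k _; rewrite ?mxE //.
    by rewrite (ord1 k) -[RHS]w0 mxE.
  by rewrite col_mxEd mxE.
- move=> j; apply/(dual_pairP _ VA) => l; case: (split_ordP j) => k ->.
    by rewrite colKl ord1 col_id mulmx0 mxE ler01.
  rewrite colKr (_ : col k t%:M = t *: delta_mx k 0) //.
  by rewrite colE mul_scalar_mx.
- move=> x _; pose w := t^-1 *: x.
  exists (col_mx (const_mx (1 - \sum_i w i 0)) w).
    rewrite /= big_split_ord /= big_ord1 col_mxEu mxE.
    by under [X in _ + X]eq_bigr do rewrite col_mxEd; rewrite subrK.
  by rewrite mul_row_col mul0mx add0r mul_scalar_mx scalerA divff ?scale1r.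
Qed.

Lemma tface1E j : tface V A [set j] = conv_hull V `&` [set x | (A^T *m x) j 0 = 1].
Proof.
by apply/seteqP; split=> x [Vx Tx]; split=> //; [exact: Tx|move=> _ ->].
Qed.

(** The d independent vertices on facet j come from [antichain_span] for the polar pair. *)
Lemma tface_facet j : inc_antichain A V -> facet d (conv_hull V) (tface V A [set j]).
Proof.
move=> sep; split; first exact: tface_face.
have [e [_ ej eU]] := spanning_basis
  (fun u => antichain_span (dual_pair_sym d0 VA) sep (i := j) (u := u)).
have jE k : (A^T *m colsub e V) j k = 1.
  by rewrite -mul_tr_sym colsub_mul_entry; apply: ej.
exists d, (colsub e V); split=> //.
- by move=> w Uw _; rewrite -(mulKmx eU w) Uw mulmx0.
- move=> k; split; last by move=> _ ->; rewrite mul_col_entry.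
  have -> : col k (colsub e V) = col (e k) V by apply/colP => i; rewrite !mxE.
  exact: conv_col.
- move=> x [_ /(_ j erefl) xj]; exists (invmx (colsub e V) *m x).
    rewrite /= -xj -[x in RHS](mulKVmx eU) mul_conv_entry.
    by apply: eq_bigr => k _; rewrite jE mul1r.
  by rewrite mulKVmx.
Qed.

(** A (d-1)-dimensional set inside a hyperplane a x = 1 contains d linearly independent
points, which determine a. *)
Lemma tight_facet_inj F j l : has_dim F (d%:Z - 1) ->
  tight A F j -> tight A F l -> col j A = col l A.
Proof.
move=> [r [W [/addIr [rd] Wi WF _]]] Fj Fl; subst r.
have tW k : tight A F k -> forall i, (A^T *m W) k i = 1.
  by move=> Fk i; rewrite -mul_col_entry; apply: Fk.
have WU : W \in unitmx.
  apply: unitmx_inj => w Ww; apply: Wi => //.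
  transitivity ((A^T *m (W *m w)) j 0); last by rewrite Ww mulmx0 mxE.
  by rewrite mul_conv_entry; apply: eq_bigr => k _; rewrite tW ?mul1r.
have : row j (A^T *m W) = row l (A^T *m W).
  by apply/rowP => i; rewrite !mxE; move: (tW j Fj i) (tW l Fl i); rewrite !mxE => -> ->.
rewrite !row_mul => /(congr1 (mulmxr (invmx W))) /=; rewrite !mulmxK //.
by rewrite -!tr_col => /trmx_inj.
Qed.

(** A facet on which no inequality is tight would be the whole polytope, contradicting
the dimension count. *)
Lemma facet_tface F : facet d (conv_hull V) F ->
  exists2 j, tight A F j & F = tface V A [set j].
Proof.
move=> [fF dF]; have FE := face_tface VA d0 fF.
have [[j Fj]|noF] := pselect (exists j, tight A F j).
  exists j => //; apply/seteqP; split=> x.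
    by move=> Fx; split=> [|_ ->]; [exact: face_sub_conv fF _ Fx|exact: Fj].
  move=> [Vx Tx]; rewrite FE; split=> // l Fl.
  have Ajl := tight_facet_inj dF Fj Fl.
  have rowE k : (A^T *m x) k 0 = ((col k A)^T *m x) 0 0.
    by rewrite tr_col -row_mul [RHS]mxE.
  by rewrite /= rowE -Ajl -rowE; apply: Tx.
have {}FE : F = conv_hull V.
  rewrite FE; apply/seteqP; split=> x; first by case.
  by move=> Vx; split=> // j Fj; case: noF; exists j.
have [r [W [/addIr [rd] Wi WF _]]] := dF; subst r.
have [s [U [sd Ui UF _]]] := dual_pair_dim.
have [r [W' [/addIr [rd] _ _ FW']]] := dF; subst r.
have := aff_indep_leq Ui (fun j => FW' _ _).
rewrite FE => /(_ UF) sled; move: sd => /eqP; rewrite -subr_eq opprK => /eqP [sd].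
by move: sled; rewrite -sd addn1 ltnn.
Qed.

End OnePair.
End Dimension.

(** * Realization spaces in terms of incidences *)

Section Labelings.
Variable R : realType.

Lemma labeled_dual_pair d n m (V : 'M[R]_(d, n)) (A : 'M[R]_(d, m)) :
  (0 < d)%N -> dual_pair V A -> inc_antichain V A -> inc_antichain A V ->
  exists Q : labeled_polytope R d d n m,
    [/\ body Q = conv_hull V, forall i, vert Q i = col i V
      & forall j, fct Q j = tface V A [set j]].
Proof.
move=> d0 VA sV sA.
have poly : polytope d (conv_hull V).
  by split; [exact: dual_pair_dim VA|exists n, V].
have vert_ok : set_bij setT (vertex (conv_hull V)) (fun i => col i V).
  split=> [i _|i l _ _|v vv]; last 1 first.
  - by have [i iv] := face_has_vertex vv erefl; exists i.
  - by rewrite /vertex -(antichain_tface VA _ sV); apply: tface_face.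
  - exact: antichain_inj sV.
have fct_ok : set_bij setT (facet d (conv_hull V)) (fun j => tface V A [set j]).
  split=> [j _|j l _ _ jl|F fF]; last 1 first.
  - by have [j _ ->] := facet_tface d0 VA fF; exists j.
  - exact: tface_facet.
  - apply/esym/sA => i /= ij.
    have : tface V A [set j] (col i V).
      by split=> [|_ ->]; [exact: conv_col|rewrite mul_col_entry -mul_tr_sym].
    by rewrite jl => -[_ /(_ l erefl)]; rewrite mul_col_entry -mul_tr_sym.
by exists (LabeledPolytope poly vert_ok fct_ok).
Qed.

(** Conversely to [labeled_dual_pair], a correct labeling forces both antichain
conditions: a vertex or a facet contained in another one is equal to it. *)
Lemma labeled_antichain d n m (V : 'M[R]_(d, n)) (A : 'M[R]_(d, m))
    (Q : labeled_polytope R d d n m) :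
  (0 < d)%N -> dual_pair V A -> body Q = conv_hull V ->
  (forall i, vert Q i = col i V) -> (forall j, fct Q j = tface V A [set j]) ->
  inc_antichain V A /\ inc_antichain A V.
Proof.
move=> d0 VA bQ vQ fQ; split.
  move=> i l il.
  have fi : face (conv_hull V) [set col i V].
    by rewrite -vQ -bQ; have [+ _ _] := vert_bij Q; apply.
  have : [set col i V] (col l V).
    rewrite (face_tface VA d0 fi); split=> [|j ij]; first exact: conv_col.
    rewrite mul_col_entry; apply: il; rewrite /inc /= -mul_col_entry.
    exact: ij.
  by rewrite /= -!vQ; apply: (set_bij_inj (vert_bij Q)); rewrite inE.
move=> j l jl.
have fj : facet d (conv_hull V) (tface V A [set j]).
  by rewrite -fQ -bQ; have [+ _ _] := fct_bij Q; apply.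
apply: (set_bij_inj (fct_bij Q)); rewrite ?inE // !fQ.
have Ajl : col j A = col l A.
  apply: (tight_facet_inj fj.2) => [x [_]|]; first exact.
  apply/(tight_vertices _ _ (tface_face VA _)) => i [_ /(_ j erefl)].
  by rewrite mul_col_entry => ij; rewrite -mul_tr_sym; apply: jl; rewrite /inc /= mul_tr_sym.
have rowE x k : (A^T *m x) k 0 = ((col k A)^T *m x) 0 0.
  by rewrite tr_col -row_mul [RHS]mxE.
rewrite !tface1E; apply/seteqP; split=> x [Vx Tx]; split=> //=.
  by rewrite rowE Ajl -rowE.
by rewrite rowE -Ajl -rowE.
Qed.

(** A face isomorphism that respects labels preserves incidence, which is inclusion of
the face {v} in the facet. *)
Lemma realizes_inc D d n m (P : labeled_polytope R D d n m)
    (Q : labeled_polytope R d d n m) i j :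
  realizes P Q -> fct P j (vert P i) <-> fct Q j (vert Q i).
Proof.
move=> [phi [_ mono vphi fphi]].
have fv : face P [set vert P i] by have [+ _ _] := vert_bij P; apply.
have ff : face P (fct P j) by have [/(_ j I) []] := fct_bij P.
have := mono _ _ fv ff; rewrite vphi fphi => mono'.
have sub1 T (x : T) (F : set T) : F x <-> [set x] `<=` F.
  by split=> [Fx _ ->|]; [|apply].
exact: iff_trans (sub1 _ _ _) (iff_trans (iff_sym mono') (iff_sym (sub1 _ _ _))).
Qed.

Lemma centered_dual_pair D d n m (P : labeled_polytope R D d n m) M :
  (0 < d)%N -> centered_realization_space P M ->
  [/\ dual_pair (lsubmx M) (rsubmx M), inc_antichain (lsubmx M) (rsubmx M),
      inc_antichain (rsubmx M) (lsubmx M) &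
      forall i j, fct P j (vert P i) <-> ((rsubmx M)^T *m lsubmx M) j i = 1].
Proof.
move=> d0 [VA [Q [bQ vQ fQ rQ]]].
have fQ' j : fct Q j = tface (lsubmx M) (rsubmx M) [set j] by rewrite fQ tface1E.
have [sV sA] := labeled_antichain d0 VA bQ vQ fQ'.
split=> // i j; rewrite (realizes_inc i j rQ) fQ vQ -mul_col_entry.
by split=> [[]|ij]; last by split; first exact: conv_col.
Qed.

(** Once the space is nonempty, membership is decided by incidences alone; the given
point M0 supplies the antichain conditions and a realization to compose with the
transfer of faces. *)
Lemma centered_realization_spaceE D d n m (P : labeled_polytope R D d n m) M0 M :
  (0 < d)%N -> centered_realization_space P M0 ->
  centered_realization_space P M <->
  dual_pair (lsubmx M) (rsubmx M) /\
  forall i j, fct P j (vert P i) <-> ((rsubmx M)^T *m lsubmx M) j i = 1.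
Proof.
move=> d0 RM0; split=> [/(centered_dual_pair d0)[] //|[VA incM]].
have [VA0 sV0 sA0 incM0] := centered_dual_pair d0 RM0.
case: RM0 => _ [Q0 [bQ0 vQ0 fQ0 [phi [bij mono vphi fphi]]]].
have s : same_inc (lsubmx M0) (lsubmx M) (rsubmx M0) (rsubmx M).
  by move=> i j; rewrite -incM0; apply: incM.
have sV := same_inc_antichain s sV0.
have sA : inc_antichain (rsubmx M) (lsubmx M).
  by apply: same_inc_antichain sA0 => j i;
     rewrite (mul_tr_sym (lsubmx M0)) (mul_tr_sym (lsubmx M)); apply: s.
have [Q [bQ vQ fQ]] := labeled_dual_pair d0 VA sV sA.
split=> //; exists Q; split=> // [j|]; first by rewrite fQ tface1E.
rewrite bQ0 in bij.
have phi_face F : face P F -> face (conv_hull (lsubmx M0)) (phi F).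
  by have [+ _ _] := bij; apply.
exists (transfer (lsubmx M) (rsubmx M) (rsubmx M0) \o phi); split.
- by rewrite bQ; apply: set_bij_comp bij (transfer_bij d0 VA0 VA s).
- move=> F G fF fG; rewrite -(mono _ _ fF fG) /=.
  by apply: (transfer_sub d0 VA0 VA s); apply: phi_face.
- by move=> i; rewrite /= vphi vQ0 vQ (transfer_vertex _ VA0 VA s).
- by move=> j; rewrite /= fphi fQ0 -tface1E (transfer_facet _ VA0 VA s) fQ.
Qed.

End Labelings.

Section Counting.
Variables (R : realType) (D d n m : nat) (P : labeled_polytope R D d n m).

(** A facet that is a simplex is the hull of at most d points by dimension, and every
vertex of P lying on it is one of these points, being extreme. *)
Lemma simplicial_card j : simplicial d P ->
  (#|[pred i | `[< fct P j (vert P i) >]]| <= d)%N.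
Proof.
move=> sP; have fj : facet d P (fct P j) by have [+ _ _] := fct_bij P; apply.
have [r [W [Wi FE]]] := sP _ fj.
have rd : (r <= d)%N.
  have [s [U [/addIr [ds] _ _ FU]]] := fj.2; rewrite ds.
  by apply: aff_indep_leq Wi _ => k; apply: FU; rewrite FE; apply: conv_col.
have colW i : fct P j (vert P i) -> exists k, vert P i = col k W.
  move=> ij; have [w [w0 w1] wi] : conv_hull W (vert P i) by rewrite -FE.
  have [k wk] := avg_supp w1; exists k.
  have [c [b [Pb vE]]] : face P [set vert P i] by have [+ _ _] := vert_bij P; apply.
  have PW l : body P (col l W).
    have [[c' [b' [_ FE']]] _] := fj.
    have : fct P j (col l W) by rewrite FE; apply: conv_col.
    by rewrite FE' => -[].
  have [_ /= vb] : (body P `&` [set x | (c^T *m x) 0 0 = b]) (vert P i) by rewrite -vE.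
  suff : [set vert P i] (col k W) by move=> ->.
  rewrite vE; split=> //=; rewrite mul_col_entry.
  apply: (avg_max w0 w1 (p := fun l => (c^T *m W) 0 l)) wk.
    by move=> l; rewrite -mul_col_entry; apply: Pb.
  by rewrite -mul_conv_entry wi.
have size_codom : size [seq col k W | k <- enum 'I_r] = r.
  by rewrite size_map -cardE card_ord.
rewrite cardE -(size_map (vert P)) (leq_trans _ rd) // -[leqRHS]size_codom.
apply: uniq_leq_size => [|_ /mapP[i iP ->]].
  by rewrite map_inj_uniq ?enum_uniq // => i l; apply: (set_bij_inj (vert_bij P)); rewrite inE.
rewrite mem_enum inE in iP; have [k ->] := colW i iP.
by apply: map_f; rewrite mem_enum.
Qed.

Lemma simple_card i : simple_polytope d P ->
  (#|[pred j | `[< fct P j (vert P i) >]]| <= d)%N.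
Proof.
move=> sP; have vi : vertex P (vert P i) by have [+ _ _] := vert_bij P; apply.
have /card_set_bijP[g [g_fun g_inj _]] := sP _ vi.
have mem j : j \in [pred j | `[< fct P j (vert P i) >]] ->
    [set F | facet d P F /\ F (vert P i)] (fct P j).
  by rewrite inE => ij; split=> //; have [+ _ _] := fct_bij P; apply.
rewrite cardE -(size_map (fun j => g (fct P j))) -[leqRHS](size_iota 0).
apply: uniq_leq_size => [|_ /mapP[j jP ->]].
  rewrite map_inj_in_uniq ?enum_uniq // => j l; rewrite !mem_enum => jP lP gjl.
  apply: (set_bij_inj (fct_bij P)); rewrite ?inE //.
  by apply: g_inj gjl; rewrite inE; apply: mem.
by rewrite mem_iota /=; apply/g_fun/mem; rewrite mem_enum in jP.
Qed.

Lemma inj_codom k p (e : 'I_k -> 'I_p) (J : set 'I_p) : injective e ->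
  (forall a, J (e a)) -> (#|[pred i | `[< J i >]]| <= k)%N ->
  forall i, J i <-> exists a, i = e a.
Proof.
move=> einj Je Jk i; split=> [Ji|[a ->//]].
have sub : codom e \subset [pred i | `[< J i >]].
  by apply/fintype.subsetP => _ /codomP[a ->]; apply/asboolP; exact: Je.
have eqc : #|codom e| = #|[pred i | `[< J i >]]|.
  by apply/eqP; rewrite eqn_leq subset_leq_card //= card_codom // card_ord.
have /(_ i) := subset_cardP eqc sub.
by rewrite [in RHS]inE asboolT // => /codomP.
Qed.

End Counting.

(** * The realization space as a graph *)

Section Openness.
Variables (R : realType) (E F : normedModType R).

Lemma Ck_subset k (U U' : set E) (f : E -> F) : U' `<=` U -> Ck k U f -> Ck k U' f.
Proof.
move=> sU; elim: k f => [|k IH] f; first by move=> cf x /sU; apply: cf.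
by move=> [df Df]; split=> [x /sU|v]; [apply: df|apply/IH/Df].
Qed.

Lemma open_finite_conditions (I : finType) (U : set E) (f : I -> E -> R)
    (O : I -> set R) : open U -> (forall i, Ck 0 U (f i)) ->
  (forall i, open (O i)) -> open [set x | U x /\ forall i, O i (f i x)].
Proof.
move=> oU cf oO; rewrite openE => x [Ux Ox].
apply: filterI; first exact: open_nbhs_nbhs.
apply: filter_forall => i; apply: (cf i x Ux).
exact: open_nbhs_nbhs.
Qed.

End Openness.

Section Solution.
Variables (R : realType) (d n m : nat) (e : 'I_n -> 'I_d -> 'I_m).

(** Column i solves the d equations a_j . v = 1 for the facets j listed in [e i]. *)
Definition vertex_solution (A : 'M[R]_(d, m)) : 'M[R]_(d, n) :=
  \matrix_(k, i) (invmx (colsub (e i) A)^T *m const_mx 1 : 'cV[R]_d) k 0.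

Definition generic : set 'M[R]_(d, m) :=
  [set A | forall i, colsub (e i) A \in unitmx].

(** The solution of the equations need not satisfy the other inequalities; strictness of
these is what excludes new incidences and makes the condition open. *)
Definition stable : set 'M[R]_(d, m) :=
  [set A | generic A /\ forall i j, ~ (exists k, j = e i k) ->
     (A^T *m vertex_solution A) j i < 1].

Lemma vertex_solutionP A V : generic A ->
  (forall i k, (A^T *m V) (e i k) i = 1) <-> V = vertex_solution A.
Proof.
move=> gA.
have colE' i : col i (vertex_solution A) = invmx (colsub (e i) A)^T *m const_mx 1.
  by apply/colP => k; rewrite !mxE.
have gA' i : (colsub (e i) A)^T \in unitmx by rewrite unitmx_tr.
split=> [eq1|-> i k].
  have colV i : col i V = col i (vertex_solution A).
    rewrite colE'; apply: (canRL (mulKmx (gA' i))); apply/colP => l.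
    by rewrite colsub_mul_entry mul_col_entry eq1 mxE.
  by apply/matrixP => k i; have /colP/(_ k) := colV i; rewrite mxE [RHS]mxE.
by rewrite -mul_col_entry -colsub_mul_entry colE' mulKVmx // mxE.
Qed.

Lemma open_generic : open generic.
Proof.
have -> : generic = [set A | setT A /\ forall i, [set x : R | x != 0] (\det (colsub (e i) A))].
  by apply/seteqP; split=> [A gA|A [_ gA]]; [split=> // i|move=> i];
     have := gA i; rewrite unitmxE unitfE.
apply: (open_finite_conditions (f := fun i A => \det (colsub (e i) A))
  (O := fun=> [set x : R | x != 0])); first exact: openT.
  move=> i; apply: Ck_det; first exact: openT.
  apply: (Ck_submx (f := id)); first exact: openT.
  by apply: Ck_linear => //; exact: linear_mx_continuous.
by move=> i; exact: open_neq.
Qed.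

Lemma smooth_vertex_solution : smooth generic vertex_solution.
Proof.
move=> k; apply: Ck_mx; first exact: open_generic.
move=> l i.
have -> : (fun A => vertex_solution A l i) =
    (fun A => \sum_b (invmx (colsub (e i) A)^T) l b).
  by apply/funext => A; rewrite !mxE; apply: eq_bigr => b _; rewrite mxE mulr1.
apply: Ck_sum => [|b]; first exact: open_generic.
apply: Ck_entry; first exact: open_generic.
apply: Ck_invmx; first exact: open_generic.
  by move=> A gA; rewrite unitmx_tr.
have lin : linear (fun A : 'M[R]_(d, m) => (colsub (e i) A)^T).
  by move=> c A B; apply/matrixP => a b'; rewrite !mxE.
exact: Ck_linear lin (linear_mx_continuous lin).
Qed.

Lemma open_stable : open stable.
Proof.
pose O (ij : 'I_n * 'I_m) : set R :=
  [set x | (exists k, ij.2 = e ij.1 k) \/ x < 1].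
have -> : stable = [set A | generic A /\
    forall ij, O ij ((A^T *m vertex_solution A) ij.2 ij.1)].
  apply/seteqP; split=> A [gA sA]; split=> //.
    by move=> [i j]; have [|] := pselect (exists k, j = e i k); [left|right; apply: sA].
  by move=> i j nT; have [] := sA (i, j).
apply: (open_finite_conditions (O := O)
  (f := fun ij A => (A^T *m vertex_solution A) ij.2 ij.1)); first exact: open_generic.
  move=> [i j].
  have -> : (fun A => (A^T *m vertex_solution A) j i) =
      (fun A => \sum_k A k j * vertex_solution A k i).
    by apply/funext => A; rewrite mxE; apply: eq_bigr => k _; rewrite mxE.
  apply: (@Ck_sum _ _ _ 0) => [|k]; first exact: open_generic.
  apply: (@CkM _ _ _ _ (fun A : 'M[R]_(d, m) => A k j) (fun A => vertex_solution A k i)).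
  - exact: open_generic.
  - exact: Ck_coord.
  - by apply: Ck_entry; [exact: open_generic|exact: smooth_vertex_solution].
move=> [i j]; have [T|nT] := pselect (exists k, j = e i k).
  suff -> : O (i, j) = setT by exact: openT.
  by apply/seteqP; split=> // x _; left.
suff -> : O (i, j) = [set x | x < 1] by exact: open_lt.
by apply/seteqP; split=> x; [case|right].
Qed.

Lemma smooth_stable : smooth stable vertex_solution.
Proof. by move=> k; apply: Ck_subset (smooth_vertex_solution k) => A []. Qed.

(** The set of dual pairs with the given simple incidences is a graph.  A dual pair with
these incidences is automatically nonsingular and stable; conversely the neighbors
found in (V0, A0) are neighbors in (V, A), since incidences agree. *)
Lemma dual_pair_near (V0 : 'M[R]_(d, n)) (A0 : 'M[R]_(d, m)) :
  (0 < d)%N -> dual_pair V0 A0 -> inc_antichain V0 A0 ->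
  generic A0 -> (forall i j, inc V0 A0 i j <-> exists k, j = e i k) ->
  forall (V : 'M[R]_(d, n)) (A : 'M[R]_(d, m)), stable A /\ V = vertex_solution A <->
    dual_pair V A /\ forall i j, inc V A i j <-> exists k, j = e i k.
Proof.
move=> d0 VA0 sep0 gA0 inc0 V A.
(* There is a vertex because the polar pair has an inequality. *)
have n0 : (0 < n)%N := dual_pair_rows d0 (dual_pair_sym d0 VA0).
split=> [[[gA sA] VE]|[VA incA]].
  have eq1 : forall i k, (A^T *m V) (e i k) i = 1 by apply/vertex_solutionP.
  have lt1 i j : ~ (exists k, j = e i k) -> (A^T *m V) j i < 1.
    by rewrite VE; apply: sA.
  split; last first.
    move=> i j; split=> [ij|[k ->]]; last exact: eq1.
    by apply: contrapT => /lt1; rewrite ij ltxx.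
  apply: (dual_pair_of_neighbors gA n0 _ eq1) => [i j|i k].
    have [[k ->]|/lt1/ltW//] := pselect (exists k, j = e i k).
    by rewrite eq1.
  have [l lk lk'] := vertex_neighbor gA0 k VA0 (inc0 i).
  have tr j : (A0^T *m V0) j l = 1 <-> (A^T *m V) j l = 1.
    split=> [/(inc0 l j)[k' ->]//|jl]; apply/(inc0 l j).
    by apply: contrapT => /lt1; rewrite jl ltxx.
  exists l => [|k' k'k]; last by apply/tr/lk'.
  apply: lt1 => /(inc0 l _).2 /= kl.
  by move: lk; rewrite kl ltxx.
have s : same_inc V0 V A0 A by move=> i j; split=> [/inc0 /incA|/incA /inc0].
have sep := same_inc_antichain s sep0.
have gA : generic A.
  move=> i; rewrite -unitmx_tr; apply: unitmx_inj => u Au.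
  apply: (antichain_span VA sep (i := i)) => j /incA[k ->].
  by rewrite -colsub_mul_entry Au mxE.
have VE : V = vertex_solution A.
  by apply/vertex_solutionP => // i k; apply/(incA i); exists k.
split=> //; split=> // i j nT; rewrite -VE lt_neqAle (dual_pair_le _ _ VA) andbT.
by apply/eqP => /(incA i j).
Qed.

End Solution.

Section Assembly.
Variable R : realType.

Lemma smooth_submanifold_flat q k (M : set 'M[R]_(0, q)) :
  smooth_submanifold (0 * k) M.
Proof.
split=> // x Mx; exists setT, setT, (fun=> 0), (fun=> 0); split=> //.
  split; [exact: openT|exact: openT|by move=> l; exact: Ck_cst|by move=> l; exact: Ck_cst|].
  split.
  - by apply/seteqP; split=> // y _; exists x => //; apply/rowP => -[].
  - by apply/seteqP; split=> // y _; exists 0 => //; rewrite [y]flatmx0.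
  - by move=> y _; rewrite [y]flatmx0.
  - by move=> y _; apply/rowP => -[].
apply/seteqP; split=> [_ [y _ <-]|y _]; first by split=> // -[].
by exists x => //; apply/rowP => -[].
Qed.

Lemma incidence_basis d n m (V : 'M[R]_(d, n)) (A : 'M[R]_(d, m)) :
  dual_pair V A -> inc_antichain V A ->
  (forall i, (#|[pred j | `[< inc V A i j >]]| <= d)%N) ->
  exists2 e : 'I_n -> 'I_d -> 'I_m, generic e A &
    forall i j, inc V A i j <-> exists k, j = e i k.
Proof.
move=> VA sep card_le.
have [e eP] : {e : 'I_n -> 'I_d -> 'I_m & forall i, colsub (e i) A \in unitmx /\
    forall j, inc V A i j <-> exists k, j = e i k}.
  apply: (@choice _ _ (fun i (e : 'I_d -> 'I_m) => colsub e A \in unitmx /\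
    forall j, inc V A i j <-> exists k, j = e k)) => i.
  have [e [einj eJ eU]] := spanning_basis (fun u => antichain_span VA sep (i := i) (u := u)).
  by exists e; split=> //; apply: inj_codom.
by exists e => [i|i j]; have [? ?] := eP i.
Qed.

End Assembly.

Theorem corollary4p7 (R : realType) (D d n m : nat)
    (P : labeled_polytope R D d n m) :
  (simplicial d P ->
     smooth_submanifold (d * n) (centered_realization_space P)) /\
  (simple_polytope d P ->
     smooth_submanifold (d * m) (centered_realization_space P)).
Proof.
have [d0|d0] := posnP d.
  by move: P; rewrite d0 => P; split=> _; exact: smooth_submanifold_flat.
have [[M0 RM0]|noM] := pselect (exists M, centered_realization_space P M); last first.
  split=> _; (split=> [|M RM]; last by case: noM; exists M);
    by rewrite leq_mul2l ?leq_addr ?leq_addl orbT.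
have [VA0 sV0 sA0 inc0] := centered_dual_pair d0 RM0.
pose V0 := lsubmx M0; pose A0 := rsubmx M0.
split=> [sP|sP].
- have AV0 := dual_pair_sym d0 VA0.
  have [e eU eE] : exists2 e : 'I_m -> 'I_d -> 'I_n, generic e V0 &
      forall j i, inc A0 V0 j i <-> exists k, i = e j k.
    apply: incidence_basis => // j; apply: leq_trans (simplicial_card j sP).
    apply: subset_leq_card; apply/fintype.subsetP => i /asboolP ij.
    by apply/asboolP/inc0; rewrite -mul_tr_sym.
  have -> : centered_realization_space P = [set M | stable e (lsubmx M) /\
      rsubmx M = vertex_solution e (lsubmx M)].
    apply/seteqP; split=> M /=.
      move=> /(centered_realization_spaceE _ d0 RM0)[VA incM].
      apply/(dual_pair_near d0 AV0 sA0 eU eE); split; first exact: dual_pair_sym.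
      move=> j i; rewrite -eE /inc /= mul_tr_sym -incM inc0.
      by rewrite -mul_tr_sym.
    move=> /(dual_pair_near d0 AV0 sA0 eU eE)[AV incM].
    apply/(centered_realization_spaceE _ d0 RM0); split; first exact: dual_pair_sym.
    move=> i j; rewrite inc0 -mul_tr_sym -[X in _ <-> X = _]mul_tr_sym.
    by apply: iff_trans (eE j i) (iff_sym (incM j i)).
  apply: (@graph_smooth_submanifold _ _ _ _ _ lsubmx rsubmx
    (fun X => row_mx X 0) (fun Y => row_mx 0 Y)) => //; try exact: linearP.
  + by move=> c X Y; rewrite scale_row_mx add_row_mx scaler0 addr0.
  + by move=> c X Y; rewrite scale_row_mx add_row_mx scaler0 addr0.
  + by move=> M; rewrite add_row_mx addr0 add0r hsubmxK.
  + by move=> X Y; rewrite add_row_mx addr0 add0r row_mxKl.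
  + by move=> X Y; rewrite add_row_mx addr0 add0r row_mxKr.
  + exact: open_stable.
  + exact: smooth_stable.
- have [e eU eE] : exists2 e : 'I_n -> 'I_d -> 'I_m, generic e A0 &
      forall i j, inc V0 A0 i j <-> exists k, j = e i k.
    apply: incidence_basis => // i; apply: leq_trans (simple_card i sP).
    apply: subset_leq_card; apply/fintype.subsetP => j /asboolP ij.
    by apply/asboolP/inc0.
  have -> : centered_realization_space P = [set M | stable e (rsubmx M) /\
      lsubmx M = vertex_solution e (rsubmx M)].
    apply/seteqP; split=> M /=.
      move=> /(centered_realization_spaceE _ d0 RM0)[VA incM].
      apply/(dual_pair_near d0 VA0 sV0 eU eE); split=> // i j.
      by rewrite -eE /inc /= -incM inc0.
    move=> /(dual_pair_near d0 VA0 sV0 eU eE)[VA incM].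
    apply/(centered_realization_spaceE _ d0 RM0); split=> // i j.
    by rewrite inc0; apply: iff_trans (eE i j) (iff_sym (incM i j)).
  apply: (@graph_smooth_submanifold _ _ _ _ _ rsubmx lsubmx
    (fun X => row_mx 0 X) (fun Y => row_mx Y 0)) => //; try exact: linearP.
  + by move=> c X Y; rewrite scale_row_mx add_row_mx scaler0 addr0.
  + by move=> c X Y; rewrite scale_row_mx add_row_mx scaler0 addr0.
  + by move=> M; rewrite add_row_mx addr0 add0r hsubmxK.
  + by move=> X Y; rewrite add_row_mx addr0 add0r row_mxKr.
  + by move=> X Y; rewrite add_row_mx addr0 add0r row_mxKl.
  + exact: open_stable.
  + exact: smooth_stable.
  + exact: addnC.
Qed.
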